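(* Let $M$ and $\widehat M$ be connected, oriented Riemannian manifolds of dimension $n$. Let $x\colon[0,\tau]\to M$ and $\widehat x\colon[0,\tau]\to\widehat M$ be absolutely continuous curves. Let $y(t)$ and $\widehat y(t)$ be any anti-development curves of $x(t)$ and $\widehat x(t)$, respectively. Then there is a rolling $q(t)$ of $M$ on $\widehat M$ with $\pi q(t)=x(t)$ and $\widehat\pi q(t)=\widehat x(t)$ for all $t\in[0,\tau]$ if and only if there is some $\iota\in\mathrm{SO}(n)$ with $\widehat y(t)=\iota(y(t))$ for all $t$. In other words, there exists a rolling along the pair of curves $x(t)$ and $\widehat x(t)$ if and only if they have the same set of anti-development curves.
   Context: Rolling. Let $M,\widehat M$ be connected, oriented Riemannian manifolds of the same dimension $n$. Let $Q=\{q\in \mathrm{SO}(T_xM,T_{\widehat x}\widehat M): x\in M,\ \widehat x\in\widehat M\}$, where $\mathrm{SO}(V,W)$ is the set of orientation preserving linear isometries between oriented inner product spaces $V$ and $W$; $Q$ is a smooth fiber bundle over $M\times\widehat M$, with projections $\pi\colon Q\to M$, $\widehat\pi\colon Q\to\widehat M$. A rolling (without slipping or twisting) of $M$ on $\widehat M$ is an absolutely continuous curve $q\colon[0,\tau]\to Q$ such that, with $x(t)=\pi q(t)$ and $\widehat x(t)=\widehat\pi q(t)$: (I) no slip: $\dot{\widehat x}(t)=q(t)\dot x(t)$ for almost all $t$; (II) no twist: $q(t)\frac{D}{dt}Z(t)=\frac{D}{dt}\big(q(t)Z(t)\big)$ for almost every $t$, for every (absolutely continuous) vector field $Z(t)$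 along $x(t)$. Here $\frac{D}{dt}$ is the covariant derivative along the curve for the Levi-Civita connection of the respective manifold. Anti-development. $F(M)$ is the bundle of positively oriented orthonormal frames, a frame at $x$ being viewed as an orientation preserving linear isometry $f\colon\mathbb R^n\to T_xM$, with $f_j=f(e_j)$ for the canonical basis $e_1,\dots,e_n$ of $\mathbb R^n$; $\mathrm{pr}_M\colon F(M)\to M$ is the projection. A curve $f(t)$ in $F(M)$ is horizontal if each $f_j(t)$ is parallel (for the Levi-Civita connection) along $\mathrm{pr}_Mf(t)$. A curve $y\colon[0,\tau]\to\mathbb R^n$ with $y(0)=0$ is an anti-development of an absolutely continuous curve $x\colon[0,\tau]\to M$ if there is a horizontal curve $f\colon[0,\tau]\to F(M)$ with $\mathrm{pr}_Mf(t)=x(t)$ and $f(t)(\dot y(t))=\dot x(t)$ for almost every $t$; explicitly, $y(t)=\int_0^tf(s)^{-1}(\dot x(s))\,ds$. *)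

(* Defs.v *)
From HB Require Import structures.
From mathcomp Require Import all_boot all_order all_algebra.
From mathcomp Require Import all_classical all_reals all_analysis.
From mathcomp Require Import ring.
Set Implicit Arguments.
Unset Strict Implicit.
Unset Printing Implicit Defensive.
Import Order.TTheory GRing.Theory Num.Theory.
Import numFieldNormedType.Exports.
Local Open Scope classical_set_scope.
Local Open Scope ring_scope.

(* Points and vectors of R^n are columns
   'cV[R]_n.  A curve on [0, tau] is a function on R of which only the values
   on `[0, tau] matter; derivatives in time are only ever taken at almost
   every t in [0, tau], so the two end points play no role. *)

Section Calculus.
Context {R : realType}.

Definition basis_vec n (k : 'I_n) : 'cV[R]_n := delta_mx k 0.

Definition partial n (k : 'I_n) (h : 'cV[R]_n -> R) (p : 'cV[R]_n) : R :=
  'D_(basis_vec k) h p.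

Fixpoint Ck_on n (k : nat) (O : set 'cV[R]_n) (h : 'cV[R]_n -> R) : Prop :=
  (forall p, O p -> {for p, continuous h}) /\
  (if k is k'.+1 then
     forall l : 'I_n, (forall p, O p -> derivable h p (basis_vec l)) /\
                      Ck_on k' O (partial l h)
   else True).

Definition smooth_on n (O : set 'cV[R]_n) (h : 'cV[R]_n -> R) : Prop :=
  forall k, Ck_on k O h.

Definition jacobian_mx n (F : 'cV[R]_n -> 'cV[R]_n) (p : 'cV[R]_n) : 'M[R]_n :=
  \matrix_(k, l) partial l (fun u => F u k 0) p.

Definition abs_cont (a b : R) (h : R -> R) : Prop :=
  forall e : R, 0 < e -> exists2 d : R, 0 < d &
    forall (m : nat) (u v : 'I_m -> R),
      (forall i, a <= u i /\ u i <= v i /\ v i <= b) ->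
      (forall i j, i != j -> v i <= u j \/ v j <= u i) ->
      \sum_(i < m) (v i - u i) < d ->
      \sum_(i < m) `|h (v i) - h (u i)| < e.

Definition abs_cont_mx m n (a b : R) (h : R -> 'M[R]_(m, n)) : Prop :=
  forall i j, abs_cont a b (fun t => h t i j).

Definition ae_on (tau : R) (P : R -> Prop) : Prop :=
  \forall t \ae (@lebesgue_measure R), `[0, tau]%classic t -> P t.

Definition special_orthogonal n (A : 'M[R]_n) : Prop :=
  A^T *m A = 1%:M /\ \det A = 1.

Definition dot n (u v : 'cV[R]_n) : R := (u^T *m v) 0 0.

Definition posbasis n (b : 'I_n -> 'cV[R]_n) : Prop :=
  0 < \det (\matrix_(k, l) b l k 0).

(* Membership in SO(V, W) for n-dimensional inner product spaces V and W with
   inner products gV, gW and sets oV, oW of positively oriented bases; the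
   dimensions being equal, an isometric linear map is bijective. *)
Definition is_SO n (V W : lmodType R) (gV : V -> V -> R) (gW : W -> W -> R)
    (oV : ('I_n -> V) -> Prop) (oW : ('I_n -> W) -> Prop) (q : V -> W) : Prop :=
  [/\ (forall (c : R) (v w : V), q (c *: v + w) = c *: q v + q w),
      (forall v w : V, gW (q v) (q w) = gV v w) &
      (forall b : 'I_n -> V, oV b -> oW (fun k => q (b k)))].

End Calculus.

(* A smooth oriented n-manifold, given by an atlas of charts
   [phi i : dom i -> R^n], with inverses [psi i], whose transition maps have
   positive Jacobian determinant. *)
Record orientedManifold (R : realType) (n : nat) := OrientedManifold {
  mpoint :> topologicalType;
  chart : Type;
  dom : chart -> set mpoint;
  phi : chart -> mpoint -> 'cV[R]_n;
  psi : chart -> 'cV[R]_n -> mpoint;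
  chart_at : mpoint -> chart;
  mhausdorff : hausdorff_space mpoint;
  msecond_countable : @second_countable mpoint;
  dom_chart_at : forall x, dom (chart_at x) x;
  dom_open : forall i, open (dom i);
  img_open : forall i, open (phi i @` dom i);
  phiK : forall i x, dom i x -> psi i (phi i x) = x;
  phi_continuous : forall i x, dom i x -> {for x, continuous (phi i)};
  psi_continuous : forall i p, (phi i @` dom i) p -> {for p, continuous (psi i)};
  trans_smooth : forall i j (k : 'I_n),
    smooth_on (phi i @` (dom i `&` dom j)) (fun p => phi j (psi i p) k 0);
  trans_oriented : forall i j p, (phi i @` (dom i `&` dom j)) p ->
    0 < \det (jacobian_mx (fun u => phi j (psi i u)) p)
}.

Definition trans_jac (R : realType) (n : nat) (M : orientedManifold R n)
    (i j : chart M) (x : M) : 'M[R]_n :=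
  jacobian_mx (fun u => phi j (psi i u)) (phi i x).

(* [gram i p] is the Gram matrix, at the point of coordinates p, of the
   coordinate vector fields of the chart i. *)
Record riemannianManifold (R : realType) (n : nat) := RiemannianManifold {
  rmanifold :> orientedManifold R n;
  gram : chart rmanifold -> 'cV[R]_n -> 'M[R]_n;
  gram_smooth : forall i (k l : 'I_n),
    smooth_on (phi i @` dom i) (fun p => gram i p k l);
  gram_sym : forall i p, (phi i @` dom i) p -> (gram i p)^T = gram i p;
  gram_pos : forall i p (u : 'cV[R]_n), (phi i @` dom i) p -> u != 0 ->
    0 < dot u (gram i p *m u);
  gram_trans : forall i j (x : rmanifold), dom i x -> dom j x ->
    gram i (phi i x) =
      (trans_jac i j x)^T *m gram j (phi j x) *m trans_jac i j x
}.

Section Tangent.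
Context {R : realType} {n : nat} (M : orientedManifold R n) (x : M).

(* A tangent vector at x is the family of its coordinates in the charts around
   x, related by the Jacobians of the transition maps (and 0 in the charts
   whose domain does not contain x). *)
Definition is_tangent (v : chart M -> 'cV[R]_n) : Prop :=
  (forall i j, dom i x -> dom j x -> v j = trans_jac i j x *m v i) /\
  (forall i, ~ dom i x -> v i = 0).

Definition tangent_pred : {pred chart M -> 'cV[R]_n} := fun v => `[< is_tangent v >].

Record tangent := Tangent {
  tcoord :> chart M -> 'cV[R]_n;
  tcoordP : tcoord \in tangent_pred
}.

HB.instance Definition _ := [isSub for tcoord].
HB.instance Definition _ := [Choice of tangent by <:].

Lemma tangent_submod_closed : submod_closed tangent_pred.
Proof.
split.
  by apply/asboolP; split=> [i j _ _|i _]; rewrite ?mulmx0.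
move=> a u v /asboolP[u1 u2] /asboolP[v1 v2]; apply/asboolP; split.
  move=> i j xi xj.
  by rewrite !fctE /= (u1 i j) // (v1 i j) // mulmxDr -scalemxAr.
by move=> i xi; rewrite !fctE /= u2 // v2 // scaler0 addr0.
Qed.

HB.instance Definition _ :=
  GRing.isSubmodClosed.Build R (chart M -> 'cV[R]_n) tangent_pred
    tangent_submod_closed.
HB.instance Definition _ := [SubChoice_isSubLmodule of tangent by <:].

Definition tangent_posbasis (b : 'I_n -> tangent) : Prop :=
  posbasis (fun k => b k (chart_at x)).

End Tangent.

Section Riemannian.
Context {R : realType} {n : nat} (M : riemannianManifold R n).

Definition inner (x : M) (v w : tangent x) : R :=
  dot (v (chart_at x)) (gram (chart_at x) (phi (chart_at x) x) *m w (chart_at x)).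

Lemma inner_chart (x : M) (i : chart M) (v w : tangent x) : dom i x ->
  inner v w = dot (v i) (gram i (phi i x) *m w i).
Proof.
move=> xi; have /asboolP[vP _] := tcoordP v; have /asboolP[wP _] := tcoordP w.
have xc := dom_chart_at x.
rewrite /inner /dot (gram_trans xc xi) (vP _ _ xc xi) (wP _ _ xc xi).
by rewrite trmx_mul !mulmxA.
Qed.

(* Gamma^k_ab = 1/2 sum_l g^kl (d_a g_bl + d_b g_al - d_l g_ab), the Christoffel
   symbols of the Levi-Civita connection in the chart i; the lemmas
   [christoffel_torsion_free] and [christoffel_metric] below are its two
   defining properties. *)
Definition christoffel (i : chart M) (p : 'cV[R]_n) (k a b : 'I_n) : R :=
  2^-1 * \sum_(l < n) invmx (gram i p) k l *
    (partial a (fun u => gram i u b l) p + partial b (fun u => gram i u a l) p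
     - partial l (fun u => gram i u a b) p).

Lemma gram_unit (i : chart M) (p : 'cV[R]_n) :
  (phi i @` dom i) p -> gram i p \in unitmx.
Proof.
move=> ip; rewrite -unitmx_tr -row_free_unit -kermx_eq0.
apply/negPn/negP => /rowV0Pn[u /sub_kermxP uG u0].
have := @gram_pos _ _ M i p u^T ip; rewrite trmx_eq0 => /(_ u0).
by rewrite /dot -[gram i p]trmxK -trmx_mul uG trmx0 mulmx0 mxE ltxx.
Qed.

Lemma partial_gram_sym (i : chart M) (p : 'cV[R]_n) (l a b : 'I_n) :
  (phi i @` dom i) p ->
  partial l (fun u => gram i u a b) p = partial l (fun u => gram i u b a) p.
Proof.
move=> ip; apply: near_eq_derive.
have := open_nbhs_nbhs (conj (@img_open _ _ M i) ip).
by apply: filterS => u iu; rewrite -[in LHS](gram_sym iu) mxE.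
Qed.

Lemma christoffel_torsion_free (i : chart M) (p : 'cV[R]_n) (k a b : 'I_n) :
  (phi i @` dom i) p -> christoffel i p k a b = christoffel i p k b a.
Proof.
move=> ip; rewrite /christoffel; congr (_ * _); apply: eq_bigr => l _.
by rewrite (partial_gram_sym l a b ip) [X in X - _]addrC.
Qed.

Lemma christoffel_lower (i : chart M) (p : 'cV[R]_n) (c a b : 'I_n) :
  (phi i @` dom i) p ->
  \sum_(d < n) christoffel i p d c a * gram i p d b =
  2^-1 * (partial c (fun u => gram i u a b) p + partial a (fun u => gram i u c b) p
          - partial b (fun u => gram i u c a) p).
Proof.
move=> ip; pose E l := partial c (fun u => gram i u a l) p
  + partial a (fun u => gram i u c l) p - partial l (fun u => gram i u c a) p.
rewrite -/(E b) /christoffel.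
under eq_bigr do rewrite -mulrA mulr_suml.
rewrite -mulr_sumr exchange_big /=; congr (_ * _).
under eq_bigr => l _.
  under eq_bigr => d _ do rewrite -/(E l) mulrAC.
  rewrite -mulr_suml.
  have -> : \sum_(d < n) invmx (gram i p) d l * gram i p d b = (l == b)%:R.
    transitivity ((gram i p *m invmx (gram i p)) b l).
      rewrite mxE; apply: eq_bigr => d _; rewrite mulrC; congr (_ * _).
      by rewrite -[in LHS](gram_sym ip) mxE.
    by rewrite mulmxV ?gram_unit // mxE eq_sym.
  over.
rewrite (bigD1 b) //= eqxx mul1r big1 ?addr0 // => l /negPf ->.
by rewrite mul0r.
Qed.

Lemma christoffel_metric (i : chart M) (p : 'cV[R]_n) (c a b : 'I_n) :
  (phi i @` dom i) p ->
  partial c (fun u => gram i u a b) p =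
  \sum_(d < n) (christoffel i p d c a * gram i p d b
                + christoffel i p d c b * gram i p a d).
Proof.
move=> ip; rewrite big_split /= christoffel_lower //.
under [X in _ = _ + X]eq_bigr => d _.
  have -> : gram i p a d = gram i p d a by rewrite -[in LHS](gram_sym ip) mxE.
  over.
rewrite christoffel_lower // (partial_gram_sym c b a ip).
by field.
Qed.

Definition christoffel_app (i : chart M) (p u w : 'cV[R]_n) : 'cV[R]_n :=
  \col_k \sum_(a < n) \sum_(b < n) christoffel i p k a b * u a 0 * w b 0.

Definition abs_cont_curve (tau : R) (x : R -> M) : Prop :=
  {within `[0, tau], continuous x} /\
  forall (i : chart M) (a b : R), 0 <= a -> b <= tau ->
    (forall t, `[a, b]%classic t -> dom i (x t)) ->
    abs_cont_mx a b (fun t => phi i (x t)).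

Definition is_velocity (x : R -> M) (t : R) (v : tangent (x t)) : Prop :=
  forall i, dom i (x t) -> is_derive t 1 (fun s => phi i (x s)) (v i).

Definition abs_cont_field (tau : R) (x : R -> M) (Z : forall t, tangent (x t)) : Prop :=
  abs_cont_curve tau x /\
  forall (i : chart M) (a b : R), 0 <= a -> b <= tau ->
    (forall t, `[a, b]%classic t -> dom i (x t)) ->
    abs_cont_mx a b (fun t => Z t i).

(* D/dt Z (t) exists and equals W: in each chart around x t,
   W^k = dZ^k/dt + Gamma^k_ab (dx^a/dt) Z^b. *)
Definition is_covderiv (x : R -> M) (Z : forall t, tangent (x t)) (t : R)
    (W : tangent (x t)) : Prop :=
  exists2 v : tangent (x t), is_velocity v &
    forall i, dom i (x t) ->
      is_derive t 1 (fun s => Z s i : 'cV[R]_n)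
        (W i - christoffel_app i (phi i (x t)) (v i) (Z t i)).

Definition parallel (tau : R) (x : R -> M) (Z : forall t, tangent (x t)) : Prop :=
  abs_cont_field tau Z /\ ae_on tau (fun t => is_covderiv Z (0 : tangent (x t))).

Record frame := Frame {
  fr_pt : M;
  fr_map :> 'cV[R]_n -> tangent fr_pt;
  fr_SO : is_SO (@dot R n) (@inner fr_pt) (@posbasis R n)
            (@tangent_posbasis R n M fr_pt) fr_map
}.

Definition horizontal (tau : R) (f : R -> frame) : Prop :=
  abs_cont_curve tau (fun t => fr_pt (f t)) /\
  forall j : 'I_n, parallel tau (fun t => f t (basis_vec j)).

Definition antidevelopment (tau : R) (x : R -> M) (y : R -> 'cV[R]_n) : Prop :=
  [/\ y 0 = 0,
      abs_cont_mx 0 tau y &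
      exists f : R -> frame,
        [/\ horizontal tau f,
            (forall t, `[0, tau]%classic t -> fr_pt (f t) = x t) &
            ae_on tau (fun t => exists2 dy : 'cV[R]_n,
              is_derive t 1 y dy &
              @is_velocity (fun s => fr_pt (f s)) t (f t dy))]].

End Riemannian.

Section Rolling.
Context {R : realType} {n : nat} (M M' : riemannianManifold R n).

Record Qspace := QPoint {
  q_pt : M;
  q_pt' : M';
  q_map :> tangent q_pt -> tangent q_pt';
  q_SO : is_SO (@inner R n M q_pt) (@inner R n M' q_pt')
           (@tangent_posbasis R n M q_pt) (@tangent_posbasis R n M' q_pt') q_map
}.

(* Q is an embedded submanifold of the bundle Hom(TM, TM') over M x M', whose
   charts are (coordinates in M, coordinates in M', matrix of the linear map in
   the coordinate bases). *)
Definition abs_cont_Q (tau : R) (q : R -> Qspace) : Prop :=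
  [/\ abs_cont_curve tau (fun t => q_pt (q t)),
      abs_cont_curve tau (fun t => q_pt' (q t)) &
      forall (i : chart M) (j : chart M') (a b : R), 0 <= a -> b <= tau ->
        (forall t, `[a, b]%classic t -> dom i (q_pt (q t)) /\ dom j (q_pt' (q t))) ->
        exists2 A : R -> 'M[R]_n, abs_cont_mx a b A &
          forall t, `[a, b]%classic t ->
            forall v : tangent (q_pt (q t)), q t v j = A t *m v i].

Definition no_slip (tau : R) (q : R -> Qspace) : Prop :=
  ae_on tau (fun t => exists2 v : tangent (q_pt (q t)),
    @is_velocity R n M (fun s => q_pt (q s)) t v &
    @is_velocity R n M' (fun s => q_pt' (q s)) t (q t v)).

Definition no_twist (tau : R) (q : R -> Qspace) : Prop :=
  forall Z : (forall t, tangent (q_pt (q t))),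
    @abs_cont_field R n M tau (fun t => q_pt (q t)) Z ->
    ae_on tau (fun t => exists2 W : tangent (q_pt (q t)),
      @is_covderiv R n M (fun s => q_pt (q s)) Z t W &
      @is_covderiv R n M' (fun s => q_pt' (q s)) (fun s => q s (Z s)) t (q t W)).

Definition is_rolling (tau : R) (q : R -> Qspace) : Prop :=
  [/\ abs_cont_Q tau q, no_slip tau q & no_twist tau q].

Definition rolling_along (tau : R) (x : R -> M) (x' : R -> M') : Prop :=
  exists2 q : R -> Qspace, is_rolling tau q &
    forall t, `[0, tau]%classic t -> q_pt (q t) = x t /\ q_pt' (q t) = x' t.

End Rolling.

(* Main.v *)
(** A horizontal frame f along x identifies a field Z along x with its
    coordinate curve z = f^-1 Z, and D/dt Z = f(z') since the f_j are parallel.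
    If q is a rolling then q f_j is parallel along x', so its coordinates in a
    horizontal frame f' along x' are absolutely continuous with derivative 0
    almost everywhere; hence f'^-1 q f is a constant rotation iota, and the no
    slip condition becomes dy'/dt = iota dy/dt.  Conversely f' iota f^-1 is a
    rolling, and f' iota is again a horizontal frame along x'.

    Both directions rest on Lebesgue's theorem that an absolutely continuous
    function h is differentiable almost everywhere and is the integral of its
    derivative.  It is obtained by writing h as the difference of two
    nondecreasing absolutely continuous functions, whose Stieltjes measures are
    dominated by the Lebesgue measure, from the Radon-Nikodym theorem and the
    Lebesgue differentiation theorem. *)

Require Import Defs.
From HB Require Import structures.
From mathcomp Require Import all_boot all_order all_algebra.
From mathcomp Require Import all_classical all_reals all_analysis.
From mathcomp Require Import measurable_realfun.
From mathcomp Require Import ring lra.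
Set Implicit Arguments.
Unset Strict Implicit.
Unset Printing Implicit Defensive.
Import Order.TTheory GRing.Theory Num.Theory.
Import numFieldNormedType.Exports.
Local Open Scope classical_set_scope.
Local Open Scope ring_scope.

(** * Absolutely continuous functions *)

Section AbsCont.
Context {R : realType}.
Implicit Types (a b c d : R) (h k : R -> R).

(* Degenerate intervals contribute to neither sum, so they are exempted from
   disjointness: they may lie inside the other intervals. *)
Lemma abs_cont_finType a b h : abs_cont a b h ->
  forall e : R, 0 < e -> exists2 d : R, 0 < d &
    forall (T : finType) (u v : T -> R),
      (forall i, a <= u i /\ u i <= v i /\ v i <= b) ->
      (forall i j, u i < v i -> u j < v j -> i != j -> v i <= u j \/ v j <= u i) ->
      \sum_i (v i - u i) < d ->
      \sum_i `|h (v i) - h (u i)| < e.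
Proof.
move=> ach e e0; have [d d0 hd] := ach e e0; exists d => // T u v uv dis.
(* The nondegenerate intervals, renumbered by [enum_val], form a disjoint family to which the
   definition applies; the others add 0 to both sums. *)
pose A := [pred i | u i < v i].
have sumA (G : T -> R) : (forall i, u i = v i -> G i = 0) ->
    \sum_i G i = \sum_(k < #|A|) G (enum_val k).
  move=> G0; rewrite -(big_enum_val G) [RHS]big_mkcond; apply: eq_bigr => i _.
  rewrite inE; have [_ [+ _]] := uv i; rewrite le_eqVlt.
  by case: ltP => //= _; rewrite orbF => /eqP /G0.
rewrite sumA => [sd|i ->]; last by rewrite subrr.
rewrite sumA => [|i ->]; last by rewrite subrr normr0.
apply: (hd _ (u \o enum_val) (v \o enum_val)) => //= i j ij.
apply: dis; [exact: (enum_valP i)|exact: (enum_valP j)|].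
by rewrite (inj_eq enum_val_inj).
Qed.

(** Domination principle behind the closure properties: each operation only needs a bound on single
    increments, which is then summed over the family of intervals. *)
Lemma abs_cont_le a b h1 h2 k (C D : R) : 0 <= C -> 0 <= D ->
  abs_cont a b h1 -> abs_cont a b h2 ->
  (forall u v, a <= u -> u <= v -> v <= b ->
    `|k v - k u| <= C * `|h1 v - h1 u| + D * `|h2 v - h2 u|) ->
  abs_cont a b k.
Proof.
move=> C0 D0 ac1 ac2 hk e e0.
(* The extra 1 keeps the divisor positive when [C] and [D] both vanish, and makes the final
   inequality strict. *)
have E0 : 0 < C + D + 1 by lra.
have eE : 0 < e / (C + D + 1) by rewrite divr_gt0.
have [d1 d10 H1] := ac1 _ eE; have [d2 d20 H2] := ac2 _ eE.
exists (Num.min d1 d2) => [|m u v uv dis]; first by rewrite lt_min d10.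
rewrite lt_min => /andP[s1 s2].
have {}H1 := H1 m u v uv dis s1; have {}H2 := H2 m u v uv dis s2.
apply: (@le_lt_trans _ _ (C * \sum_(i < m) `|h1 (v i) - h1 (u i)|
                          + D * \sum_(i < m) `|h2 (v i) - h2 (u i)|)).
  rewrite !mulr_sumr -big_split /=; apply: ler_sum => i _.
  by have [? []] := uv i; exact: hk.
have -> : e = (C + D + 1) * (e / (C + D + 1)) by rewrite mulrCA divff ?mulr1 ?gt_eqF.
nra.
Qed.

Lemma abs_cont_eq a b h k : (forall t, `[a, b]%classic t -> h t = k t) ->
  abs_cont a b h -> abs_cont a b k.
Proof.
move=> hk ach; apply: (@abs_cont_le _ _ h h _ 1 0) => // u v au uv vb.
rewrite -!hk ?mul0r ?addr0 ?mul1r //= in_itv /= ?au ?vb ?andbT //.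
  exact: le_trans vb.
exact: le_trans uv.
Qed.

Lemma abs_cont_cst a b (c : R) : abs_cont a b (fun=> c).
Proof.
move=> e e0; exists 1 => // m u v _ _ _.
by rewrite big1 // => i _; rewrite subrr normr0.
Qed.

Lemma abs_contD a b h k : abs_cont a b h -> abs_cont a b k ->
  abs_cont a b (fun t => h t + k t).
Proof.
move=> ach ack; apply: (@abs_cont_le _ _ h k _ 1 1) => // u v _ _ _.
rewrite !mul1r (_ : _ - _ = (h v - h u) + (k v - k u)); last by ring.
exact: ler_normD.
Qed.

Lemma abs_contZ a b c h : abs_cont a b h -> abs_cont a b (fun t => c * h t).
Proof.
move=> ach; apply: (@abs_cont_le _ _ h h _ `|c| 0) => // u v _ _ _.
by rewrite mul0r addr0 -mulrBr normrM.
Qed.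

Lemma abs_contN a b h : abs_cont a b h -> abs_cont a b (fun t => - h t).
Proof.
move=> ach; apply: (@abs_cont_le _ _ h h _ 1 0) => // u v _ _ _.
by rewrite mul0r addr0 mul1r -opprD normrN.
Qed.

Lemma abs_cont_continuous a b h : abs_cont a b h ->
  {within `[a, b], continuous h}.
Proof.
move=> ach; apply/subspace_continuousP => x; rewrite /= in_itv /= => /andP[ax xb].
apply/cvgrPdist_lt => e e0; have [d d0 hd] := ach e e0.
have K u v : a <= u -> u <= v -> v <= b -> `|u - v| < d -> `|h u - h v| < e.
  move=> au uv vb uvd.
  have := hd 1%N (fun=> u) (fun=> v); rewrite !big_ord1 distrC; apply=> //.
    by move=> i j; rewrite !ord1 eqxx.
  by rewrite -(ger0_norm (_ : 0 <= v - u)) ?subr_ge0 // distrC.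
rewrite near_withinE; near=> y; rewrite /= in_itv /= => /andP[ay yb].
have xyd : `|x - y| < d by near: y; exact: nbhsx_ballx.
have [xy|/ltW yx] := leP x y; first exact: K.
by rewrite distrC; apply: K => //; rewrite distrC.
Unshelve. all: by end_near. Qed.

Lemma abs_cont_bounded a b h : abs_cont a b h ->
  exists2 C, 0 <= C & forall t, `[a, b]%classic t -> `|h t| <= C.
Proof.
move=> ach; have [ab|ba] := leP a b; last first.
  exists 0 => // t; rewrite /= in_itv /= => /andP[at_ tb].
  by move: (lt_le_trans ba (le_trans at_ tb)); rewrite ltxx.
have [|c cab cmax] := @EVT_max R (fun t => `|h t|) a b ab.
  move=> t; apply: cvg_norm; exact: abs_cont_continuous ach t.
by exists `|h c| => // t tab; apply: cmax.
Qed.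

Lemma abs_contM a b h k : abs_cont a b h -> abs_cont a b k ->
  abs_cont a b (fun t => h t * k t).
Proof.
move=> ach ack; have [C C0 hC] := abs_cont_bounded ach.
have [D D0 kD] := abs_cont_bounded ack.
apply: (@abs_cont_le _ _ h k _ D C) => // u v au uv vb.
have -> : h v * k v - h u * k u = (h v - h u) * k v + h u * (k v - k u) by ring.
rewrite (le_trans (ler_normD _ _)) // !normrM [D * _]mulrC lerD //.
  by rewrite ler_wpM2l // kD //= in_itv /= vb andbT (le_trans au).
by rewrite ler_wpM2r // hC //= in_itv /= au (le_trans uv).
Qed.

Lemma abs_contV a b h : abs_cont a b h ->
  (forall t, `[a, b]%classic t -> h t != 0) -> abs_cont a b (fun t => (h t)^-1).
Proof.
move=> ach h0; have [ab|ba] := leP a b; last first.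
  (* For [b < a] the only admissible family of intervals is the empty one. *)
  move=> e e0; exists 1 => // -[|m] u v uv; first by rewrite !big_ord0.
  have [au [uv0 vb]] := uv ord0.
  by move: (lt_le_trans ba (le_trans au (le_trans uv0 vb))); rewrite ltxx.
have [|c cab cmin] := @EVT_min R (fun t => `|h t|) a b ab.
  move=> t; apply: cvg_norm; exact: abs_cont_continuous ach t.
have hc := h0 _ cab.
(* The increments of 1/h are those of [h] divided by [h u * h v], whose absolute value is at least
   [|h c|^2] because [c] minimises [|h|] on the compact interval. *)
apply: (@abs_cont_le _ _ h h _ (`|h c|^-1 * `|h c|^-1) 0) => //.
move=> u v au uv vb; rewrite mul0r addr0.
have uab : u \in `[a, b] by rewrite in_itv /= au (le_trans uv).
have vab : v \in `[a, b] by rewrite in_itv /= vb andbT (le_trans au).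
have hu := h0 _ uab; have hv := h0 _ vab.
have -> : (h v)^-1 - (h u)^-1 = (h v)^-1 * (h u)^-1 * (h u - h v) by field; rewrite hu.
rewrite !normrM distrC ler_wpM2r // !normfV ler_pM ?invr_ge0 //.
  by rewrite lef_pV2 ?posrE ?normr_gt0 // cmin.
by rewrite lef_pV2 ?posrE ?normr_gt0 // cmin.
Qed.

End AbsCont.

(** * Partitions and total variation of absolutely continuous functions *)

Section AbsContVariation.
Context {R : realType}.
Implicit Types (a b c d : R) (h : R -> R) (s : seq R).

Lemma itv_partition_nth_le a b s : itv_partition a b s ->
  {in [pred i | (i <= size s)%N] &,
    {homo nth b (a :: s) : i j / (i <= j)%N >-> i <= j}}.
Proof.
move=> abs i j; rewrite !inE => is_ js ij.
have step := nondecreasing_fun_itv_partition (f := id) (fun _ _ _ _ xy => xy) abs.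
elim: j js ij => [|j IH] js; first by rewrite leqn0 => /eqP ->.
rewrite leq_eqVlt => /predU1P[->//|]; rewrite ltnS => ij.
exact: le_trans (IH (ltnW js) ij) (step _ js).
Qed.

Lemma itv_partition_nth_size a b s : itv_partition a b s ->
  nth b (a :: s) (size s) = b.
Proof. by move=> [_ /eqP <-]; rewrite -[in LHS]last_nth; case: s. Qed.

Lemma itv_partition_nth_itv a b s : itv_partition a b s ->
  forall i, (i < size s)%N ->
  let F := nth b (a :: s) in a <= F i /\ F i <= F i.+1 /\ F i.+1 <= b.
Proof.
move=> abs i si F; have mono := itv_partition_nth_le abs; split.
  by apply: (mono 0%N); rewrite ?inE // ltnW.
split; first by apply: mono; rewrite ?inE ?(ltnW si).
rewrite -[leRHS](itv_partition_nth_size abs).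
by apply: mono; rewrite ?inE.
Qed.

Lemma itv_partition_nth_disj a b s : itv_partition a b s ->
  forall i j, (i < size s)%N -> (j < size s)%N -> i != j ->
  let F := nth b (a :: s) in F i.+1 <= F j \/ F j.+1 <= F i.
Proof.
move=> abs i j si sj ij F; have mono := itv_partition_nth_le abs.
by move: ij; rewrite neq_ltn => /orP[] ij; [left|right];
  apply: mono; rewrite ?inE // ltnW.
Qed.

Lemma itv_partition_sum a b s : itv_partition a b s ->
  let F := nth b (a :: s) in \sum_(i < size s) (F i.+1 - F i) = b - a.
Proof.
move=> abs F; rewrite -(big_mkord xpredT (fun i => F i.+1 - F i)).
by rewrite telescope_sumr // /F itv_partition_nth_size.
Qed.

(** For the [d] that answers to e = 1, every interval shorter than [d] has variation at most 1;
    finitely many of them, glued by additivity of the total variation, cover the whole interval. *)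
Lemma abs_cont_bounded_variation a b h : a <= b -> abs_cont a b h ->
  bounded_variation a b h.
Proof.
move=> ab ach; have [d d0 hd] := ach _ ltr01.
have small u v : a <= u -> u <= v -> v <= b -> v - u < d ->
    bounded_variation u v h.
  move=> au uv vb uvd; exists 1 => _ [s us <-].
  rewrite /variation big_mkord; apply: ltW; apply: hd => [i|i j ij|].
  - have [? [? ?]] := itv_partition_nth_itv us (ltn_ord i).
    by split; [exact: le_trans au _|split => //; exact: le_trans vb].
  - exact: itv_partition_nth_disj.
  - by rewrite itv_partition_sum.
(* [k] counts the steps of length [d / 2] from [a] to [b]; half of [d] makes each step strictly
   shorter than [d]. *)
have [k kba] : exists k : nat, b - a <= k%:R * (d / 2).
  exists (Num.bound ((b - a) / (d / 2))).
  rewrite -ler_pdivrMr ?divr_gt0 //; apply: ltW.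
  by apply: archi_boundP; rewrite divr_ge0 ?subr_ge0 // divr_ge0 // ltW.
suff main (c : R) : c - a <= k%:R * (d / 2) -> a <= c -> c <= b ->
    bounded_variation a c h by exact: main.
elim: k {kba} c => [|k IH] c cak ac cb.
  move: cak; rewrite mul0r subr_le0 => ca.
  by rewrite (le_anti (introT andP (conj ac ca))); exact: bounded_variationxx.
(* One step back from [c], cut off at [a]: induction covers the part up to [c0], and [small] covers
   the rest. *)
pose c0 := Num.max a (c - d / 2).
have ac0 : a <= c0 by rewrite le_max lexx.
have c0c : c0 <= c by rewrite ge_max ac gerBl divr_ge0 // ltW.
have c0b := le_trans c0c cb.
apply/bounded_variationP => //; rewrite (total_variationD h ac0 c0c).
rewrite fin_numD; apply/andP; split; apply/bounded_variationP => //.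
  apply: IH => //.
  rewrite lerBlDr ge_max; apply/andP; split.
    by rewrite lerDr mulr_ge0 // divr_ge0 // ltW.
  by move: cak; rewrite -natr1; lra.
apply: small => //; have : c - d / 2 <= c0 by rewrite le_max lexx orbT.
lra.
Qed.

(** The variation over each interval of a family is nearly attained by a partition, and all these
    partitions together form one disjoint family of the same total length, to which the absolute
    continuity of [h] applies. *)
Lemma abs_cont_total_variation a b h : a <= b -> abs_cont a b h ->
  abs_cont a b (fun t => fine (total_variation a t h)).
Proof.
move=> ab ach; have bvh := abs_cont_bounded_variation ab ach.
have fin u v : a <= u -> u <= v -> v <= b -> total_variation u v h \is a fin_num.
  move=> au uv vb; apply/bounded_variationP => //.
  apply: (bounded_variationl uv vb).
  exact: (bounded_variationr au (le_trans uv vb) bvh).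
move=> e e0; have e20 : 0 < e / 2 by rewrite divr_gt0.
have [d d0 hd] := abs_cont_finType ach e20; exists d => // m u v uv dis sd.
(* The tolerance for one interval: [m] of them add up to at most [e / 2], and [m.+1] avoids dividing
   by 0 for the empty family. *)
have em0 : 0 < e / 2 / m.+1%:R by rewrite divr_gt0.
have /choice[s hs] : forall i, exists s, itv_partition (u i) (v i) s /\
    fine (total_variation (u i) (v i) h) <=
      variation (u i) (v i) h s + e / 2 / m.+1%:R.
  move=> i; have [au [uvi vb]] := uv i.
  have finT := fin _ _ au uvi vb.
  have [_ [_ [s us <-] <-]] := ub_ereal_sup_adherent em0 finT.
  rewrite -/(total_variation _ _ _) -(fineK finT) -EFinB lte_fin => lt.
  by exists s; split => //; rewrite -lerBlDr ltW.
have E i : `|fine (total_variation a (v i) h) - fine (total_variation a (u i) h)|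
    = fine (total_variation (u i) (v i) h).
  have [au [uvi vb]] := uv i.
  rewrite (total_variationD h au uvi) fineD ?fin ?(le_trans uvi) // addrC addKr.
  by rewrite ger0_norm // fine_ge0 // total_variation_ge0.
under eq_bigr do rewrite E.
apply: (@le_lt_trans _ _ (\sum_(i < m)
   (variation (u i) (v i) h (s i) + e / 2 / m.+1%:R))).
  by apply: ler_sum => i _; exact: (hs i).2.
rewrite big_split /= sumr_const card_ord [ltRHS]splitr.
apply: ltr_leD; last first.
  by rewrite -[_ *+ m]mulr_natr mulrAC ler_pdivrMr // ler_pM2l // ler_nat.
(* A pair in [T] names an original interval and one piece of its partition, so the double sums
   become sums over a single finite type. *)
pose T := {i : 'I_m & 'I_(size (s i))}.
pose F i := nth (v i) (u i :: s i).
have := hd T (fun p => F (tag p) (tagged p)) (fun p => F (tag p) (tagged p).+1).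
rewrite -(sig_big_dep xpredT (fun=> xpredT)
  (fun i (k : 'I_(size (s i))) => F i k.+1 - F i k)).
rewrite -(sig_big_dep xpredT (fun=> xpredT)
  (fun i (k : 'I_(size (s i))) => `|h (F i k.+1) - h (F i k)|)).
move=> H; under eq_bigr do rewrite /variation big_mkord.
have bd i (k : 'I_(size (s i))) := itv_partition_nth_itv (hs i).1 (ltn_ord k).
apply: H => [[i k]|[i k] [j l] _ _ ne|] /=.
- have [? [? ?]] := bd i k; have [au [_ vb]] := uv i.
  by split; [exact: le_trans au _|split => //; exact: le_trans vb].
- have [ij|ij] := eqVneq i j.
    subst j; apply: itv_partition_nth_disj => //; first exact: (hs i).1.
    by apply: contra ne => /eqP /val_inj ->.
  have [? [? ?]] := bd i k; have [? [? ?]] := bd j l.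
  have [vu|vu] := dis _ _ ij; [left|right].
    by apply: le_trans (le_trans vu _).
  by apply: le_trans (le_trans vu _).
- under eq_bigr => i _ do rewrite (itv_partition_sum (hs i).1).
  exact: sd.
Qed.

End AbsContVariation.

(** * Lebesgue's theorem on absolutely continuous functions *)

Section Stieltjes.
Context {R : realType}.
Notation mu := (@lebesgue_measure R).
Implicit Types (a b c d : R).

(** The end points are those of the interval hull; finite measure excludes infinite ends, except for
    the empty set, which gets 0 and 0. The outer interval is half-open because Stieltjes measures
    are explicit on such intervals. *)
Lemma open_interval_bounds (I : set R) : open I -> is_interval I ->
  (mu I < +oo)%E ->
  exists u v : R, [/\ u <= v, mu I = (v - u)%:E, I `<=` `]u, v] & `]u, v[ `<=` I].
Proof.
move=> oI iI; have E : I = [set` Rhull I] by rewrite RhullK // inE.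
(* An open set contains none of its lower bounds, so the left end point may be left out of the
   enclosing interval. *)
have lb u : (forall x, I x -> u <= x) -> ~ I u.
  move=> uI Iu; have /nbhs_ballP[e /= e0 eI] := open_nbhs_nbhs (conj oI Iu).
  have /uI : I (u - e / 2).
    apply: eI; rewrite /ball /= opprB addrC subrK gtr0_norm ?divr_gt0 //.
    by rewrite ltr_pdivrMr // ltr_pMr // ltr1n.
  by rewrite lerBrDr gerDl leNgt divr_gt0.
have muE : mu I = mu [set` Rhull I] by rewrite -E.
rewrite muE lebesgue_measure_itv {muE}; move: E.
case: (Rhull I) => -[x a|[]] [y b|[]] //= E; rewrite ?ltry ?ltNyr ?ltxx //=.
  (* The maximum covers the case [b < a], where the set is empty and has length 0. *)
  move=> _; exists a, (Num.max a b); split.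
  + by rewrite le_max lexx.
  + rewrite lte_fin; case: ltP => [ab|ba]; first by rewrite EFinB.
    by rewrite subrr.
  + move=> z Iz; move: (Iz); rewrite E /= in_itv /= => /andP[az zb].
    rewrite in_itv /=; apply/andP; split.
      rewrite lt_neqAle (lteifW az) andbT; apply/eqP => ?; subst z.
      apply: (lb a) => // w; rewrite E /= in_itv /= => /andP[+ _].
      exact: lteifW.
    by rewrite le_max (lteifW zb) orbT.
  + move=> z; rewrite E /= !in_itv /= lt_max => /andP[az].
    rewrite lt_gtF //= => zb; apply/andP; split; exact: lteifS.
all: move=> _; exists 0, 0; rewrite lexx subrr.
all: have I0 : I = set0.
all: try by rewrite E; apply/seteqP; split => z //=; rewrite in_itv /= ?andbF.
all: rewrite I0; split=> // z /=; rewrite in_itv /= => /andP[z0 /(lt_trans z0)].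
all: by rewrite ltxx.
Qed.

Lemma lebesgue_stieltjes_oc (F : cumulative R R) u v : u <= v ->
  lebesgue_stieltjes_measure F `]u, v] = (F v - F u)%:E.
Proof.
move=> uv; rewrite /lebesgue_stieltjes_measure /measure_extension.
by rewrite measurable_mu_extE /=; [rewrite wlength_itv_bnd|exact: is_ocitv].
Qed.

Variable F : cumulative R R.
Notation nu := (lebesgue_stieltjes_measure F).

(* A Lebesgue-null set lies in an open set of small measure, whose components
   are disjoint intervals to which the absolute continuity of F applies. *)
Lemma stieltjes_dominated :
  (forall e : R, 0 < e -> exists2 d : R, 0 < d &
    forall (N : nat) (u v : 'I_N -> R),
      (forall i, u i <= v i) ->
      (forall i j, u i < v i -> u j < v j -> i != j -> v i <= u j \/ v j <= u i) ->
      \sum_i (v i - u i) < d ->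
      \sum_i (F (v i) - F (u i)) < e) ->
  nu `<< mu.
Proof.
move=> acF; apply/null_content_dominatesP => A mA A0.
apply/eqP; rewrite eq_le measure_ge0 andbT; apply/lee_addgt0Pr => e e0.
rewrite add0e; have [d d0 hd] := acF e e0.
have [|U [oU AU UA]] := lebesgue_regularity_outer mA _ d0; first by rewrite A0.
have mU : measurable U by exact: open_measurable.
have muU : (mu U < d%:E)%E.
  apply: le_lt_trans UA; rewrite -[U in leLHS](setDKU AU).
  apply: le_trans (measureU2 _ _ _) _ => //; first exact: measurableD.
  by rewrite A0 adde0.
apply: (@le_trans _ _ (nu U)); first by apply: le_measure => //; rewrite inE.
rewrite (open_disjoint_itv_bigcup oU); set I := open_disjoint_itv oU.
have mI i : measurable (I i) by apply: open_measurable; exact: open_disjoint_itv_open.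
have tI : trivIset setT I by exact: open_disjoint_itv_trivIset.
have IU i : I i `<=` U.
  by rewrite [U](open_disjoint_itv_bigcup oU) => z Iz; exists i.
have /choice[u /choice[v uvI]] : forall i, exists u v : R,
   [/\ u <= v, mu (I i) = (v - u)%:E, I i `<=` `]u, v] & `]u, v[ `<=` I i].
  move=> i; apply: open_interval_bounds.
  - exact: open_disjoint_itv_open.
  - exact: open_disjoint_itv_is_interval.
  - apply: (@le_lt_trans _ _ (mu U)); last exact: lt_trans muU (ltry _).
    by apply: le_measure; rewrite ?inE; [exact: mI|exact: mU|exact: IU].
rewrite (measure_bigcup nu setT I) //; last by move=> i _; exact: mI.
(* Absolute continuity concerns finite families, so the series over the components is bounded
   through its partial sums. *)
apply: lime_le.
  by apply: is_cvg_nneseries => n _ _; exact: measure_ge0.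
near=> N; rewrite big_mkcond /= big_mkord.
apply: (@le_trans _ _ (\sum_(i < N) (F (v i) - F (u i)))%:E); last first.
  rewrite lee_fin ltW //; apply: hd => [i|i j ui uj ij|].
  - by have [] := uvI i.
  - rewrite leNgt; case: ltP => [uv|]; last by left.
    right; rewrite leNgt; apply/negP => uv'.
    (* If two intervals overlapped, the midpoint of the overlap would lie in two disjoint
       components. *)
    pose z := (Num.max (u i) (u j) + Num.min (v i) (v j)) / 2.
    have /midf_lt zP : Num.max (u i) (u j) < Num.min (v i) (v j).
      by rewrite gt_max !lt_min ui uj uv uv'.
    have [_ _ _ Ii] := uvI i; have [_ _ _ Ij] := uvI j.
    move: zP; rewrite gt_max lt_min -/z => -[/andP[z1 z2] /andP[z3 z4]].
    move/trivIsetP: tI => /(_ i j Logic.I Logic.I ij); apply/eqP/set0P; exists z.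
    by split; [apply: Ii|apply: Ij]; rewrite /= in_itv /= ?z1 ?z2 ?z3 ?z4.
  - rewrite -lte_fin; apply: le_lt_trans muU; rewrite -sumEFin.
    under eq_bigr => i _ do have [_ <- _ _] := uvI i.
    rewrite -(measure_bigsetU mu) //.
    apply: le_measure; rewrite ?inE; [|exact: mU|].
      by apply: bigsetU_measurable => i _; exact: mI.
    by rewrite -(bigcup_mkord N I) => z [i _ /IU].
rewrite -sumEFin; apply: lee_sum => i _; rewrite in_setT.
have [uv _ IJ _] := uvI i; rewrite -lebesgue_stieltjes_oc //.
by apply: le_measure; rewrite ?inE; [exact: mI|exact: measurable_itv|].
Unshelve. all: by end_near. Qed.

End Stieltjes.

(** * Densities and almost everywhere derivatives of absolutely continuous functions *)

Section Density.
Context {R : realType}.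
Notation mu := (@lebesgue_measure R).
Implicit Types (a b c d : R).

(** For [a <= b], the retraction of the line onto [a, b]; composing with it extends a function by
    its end values. *)
Definition clamp a b t : R := Num.max a (Num.min t b).

Lemma clamp_itv a b t : a <= b -> a <= clamp a b t /\ clamp a b t <= b.
Proof. by move=> ab; rewrite le_max lexx ge_max ab ge_min lexx orbT. Qed.

Lemma clamp_id a b t : a <= t -> t <= b -> clamp a b t = t.
Proof. by move=> at_ tb; rewrite /clamp min_l // max_r. Qed.

Lemma clamp_le a b : {homo clamp a b : x y / x <= y}.
Proof.
move=> x y xy; rewrite /clamp ge_max le_max lexx /= le_max; apply/orP; right.
by rewrite le_min !ge_min xy lexx orbT.
Qed.

Lemma clamp_lip a b x y : a <= b -> x <= y ->
  clamp a b y - clamp a b x <= y - x.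
Proof.
move=> ab xy; rewrite /clamp.
have [?|?] := leP x b; have [?|?] := leP y b;
 rewrite ?(maxC a); repeat (let h := fresh in case: (leP _ a) => h); lra.
Qed.

(** [clamp] is monotone and 1-Lipschitz, so it carries a disjoint family to one of no greater
    length. It may collapse intervals to points, hence the appeal to [abs_cont_finType]. *)
Lemma abs_cont_uniform_clamp a b h : a <= b -> abs_cont a b h ->
  forall e : R, 0 < e -> exists2 d : R, 0 < d &
    forall (N : nat) (u v : 'I_N -> R),
      (forall i, u i <= v i) ->
      (forall i j, u i < v i -> u j < v j -> i != j -> v i <= u j \/ v j <= u i) ->
      \sum_i (v i - u i) < d ->
      \sum_i `|h (clamp a b (v i)) - h (clamp a b (u i))| < e.
Proof.
move=> ab ach e e0; have [d d0 hd] := abs_cont_finType ach e0.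
exists d => // N u v uv dis sd.
apply: (hd _ (fun i => clamp a b (u i)) (fun i => clamp a b (v i))).
- move=> i; have [? _] := clamp_itv (u i) ab; have [_ ?] := clamp_itv (v i) ab.
  by split => //; split => //; exact: clamp_le.
- move=> i j ui uj ij.
  have lt x y : clamp a b x < clamp a b y -> x < y.
    by rewrite !ltNge; apply: contra => /(@clamp_le a b).
  by have [?|?] := dis i j (lt _ _ ui) (lt _ _ uj) ij; [left|right]; exact: clamp_le.
- by apply: le_lt_trans sd; apply: ler_sum => i _; exact: clamp_lip.
Qed.

Lemma abs_cont_continuous_at a b h t : abs_cont a b h -> a < t -> t < b ->
  {for t, continuous h}.
Proof.
move=> /abs_cont_continuous ach at_ tb.
have ab := lt_trans at_ tb.
have /(continuous_within_itvP _ ab)[+ _ _] := ach.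
by apply; rewrite in_itv /= at_.
Qed.

(** The density is the Radon-Nikodym derivative of the Stieltjes measure of [F], extended to the
    line by its end values so as to be a cumulative function. *)
Lemma nondecreasing_abs_cont_density a b (F : R -> R) : a < b ->
  {in `[a, b] &, nondecreasing_fun F} -> abs_cont a b F ->
  exists g : R -> R, [/\ mu.-integrable setT (EFin \o g),
    forall t, `[a, b]%classic t ->
      (F t - F a)%:E = (\int[mu]_(x in `]a, t]) (g x)%:E)%E &
    {ae mu, forall t, `]a, b[%classic t -> is_derive t 1 F (g t)}].
Proof.
move=> ab ndF acF; pose G := F \o clamp a b.
have leab := ltW ab.
have GE t : a <= t -> t <= b -> G t = F t by move=> *; rewrite /G /= clamp_id.
have ndG : nondecreasing G.
  move=> x y xy; apply: ndF; rewrite ?in_itv /=; last exact: clamp_le.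
    by have [-> ->] := clamp_itv x leab.
  by have [-> ->] := clamp_itv y leab.
have acG := abs_cont_uniform_clamp leab acF.
have cG : continuous G.
  move=> x; apply: (@abs_cont_continuous_at (x - 1) (x + 1)); rewrite ?ltrDl ?gtrBl //.
  move=> e e0; have [d d0 hd] := acG _ e0; exists d => // m u v uv dis.
  apply: hd => [i|i j _ _]; last exact: dis.
  by have [_ []] := uv i.
pose f : cumulative R R := HB.pack G
  (isCumulative.Build R _ R G ndG (right_continuousW cG)).
pose nu := lebesgue_stieltjes_measure f.
have numu : nu `<< mu.
  apply: stieltjes_dominated => e e0; have [d d0 hd] := acG _ e0.
  exists d => // N u v uv dis sd; have := hd N u v uv dis sd.
  apply: le_lt_trans; apply: ler_sum => i _; exact: ler_norm.
have mab : measurable (`]a, b]%classic : set (measurableTypeR R)).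
  exact: measurable_itv.
have nuab : (lebesgue_stieltjes_measure f `]a, b]%classic < +oo)%E.
  by rewrite lebesgue_stieltjes_oc // ltry.
(* Restricting to []a, b]] gives a finite measure that still sees every increment of [F] between [a]
   and [b]. *)
pose rho : {finite_measure set (measurableTypeR R) -> \bar R} := mfrestr mab nuab.
have rhomu : rho `<< mu.
  apply/null_content_dominatesP => A mA A0.
  have : nu A = 0%E by move/null_content_dominatesP : numu; exact.
  move=> nuA; apply/eqP; rewrite eq_le measure_ge0 andbT -nuA.
  rewrite /rho /mfrestr /mrestr; apply: le_measure; rewrite ?inE //.
  exact: measurableI.
have [k [k0 kfin kint kE]] := radon_nikodym_sigma_finite rhomu.
pose g := fine \o k.
have gE : EFin \o g = k by apply/funext => z /=; rewrite fineK.
have gint t : a <= t -> t <= b ->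
    (F t - F a)%:E = (\int[mu]_(x in `]a, t]) (g x)%:E)%E.
  move=> at_ tb; transitivity (rho `]a, t]%classic).
    rewrite /rho /= /mfrestr /mrestr (_ : _ `&` _ = `]a, t]%classic).
      by rewrite lebesgue_stieltjes_oc //= -!GE.
    apply/setIidPl => z /=; rewrite !in_itv /= => /andP[-> zt].
    exact: le_trans tb.
  rewrite kE; last exact: measurable_itv.
  by apply: eq_integral => z _; rewrite -[RHS]/((EFin \o g) z) gE.
exists g; rewrite gE; split => //.
  by move=> t /=; rewrite in_itv /= => /andP[? ?]; exact: gint.
(* Lebesgue differentiation: the integral of [g] from [a] has derivative [g] at almost every point
   beyond [a]. *)
have := @FTC1 R g (BRight a); rewrite gE => /(_ _ _)/= FTC.
have /FTC : forall y, mu.-integrable `]a, y] k.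
  by move=> y; apply: integrableS kint => //; exact: measurable_itv.
have locg : locally_integrable [set: R] g.
  by apply: open_integrable_locally; [exact: openT|rewrite gE].
move=> /(_ locg); apply: filterS; first exact: (ae_filter_ringOfSetsType mu).
move=> t + /=; rewrite in_itv /= => + /andP[at_ tb] => /(_ _)[|+ <-].
  by rewrite ?bnd_simp.
set H := (H in derivable H) => dH.
(* [F] is known to be the integral only between [a] and [b]; as [t] is interior, agreement near [t]
   transfers the derivative. *)
have nearE : \forall s \near t, H s + F a = F s.
  near=> s; have as_ : a < s by near: s; exact: lt_nbhsr.
  have sb : s < b by near: s; exact: lt_nbhsl.
  rewrite /H /Rintegral; have := gint s (ltW as_) (ltW sb).
  by move=> <- /=; rewrite subrK.
have dHF : is_derive (t : R) 1 (fun s : R => H s + F a) (derive1 H t).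
  have dH1 : is_derive (t : R) 1 H (derive1 H t) by rewrite derive1E; exact: derivableP.
  have := @is_deriveD R R R H (cst (F a)) t 1 _ _ dH1 (is_derive_cst _ _ _).
  by rewrite addr0.
exact: near_eq_is_derive nearE dHF.
Unshelve. all: by end_near. Qed.

(** Jordan decomposition: with [V] the variation from [a] and [W = V - h], both are nondecreasing
    since [V] grows at least as fast as [|h|] can change, and the densities subtract. *)
Lemma abs_cont_density a b (h : R -> R) : a < b -> abs_cont a b h ->
  exists g : R -> R, [/\ mu.-integrable setT (EFin \o g),
    forall t, `[a, b]%classic t ->
      (h t - h a)%:E = (\int[mu]_(x in `]a, t]) (g x)%:E)%E &
    {ae mu, forall t, `]a, b[%classic t -> is_derive t 1 h (g t)}].
Proof.
move=> ab ach; have leab := ltW ab.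
pose V t := fine (total_variation a t h); pose W t := V t - h t.
have acV : abs_cont a b V by exact: abs_cont_total_variation.
have acW : abs_cont a b W by apply: abs_contD => //; exact: abs_contN.
have bvh := abs_cont_bounded_variation leab ach.
have incV x y : a <= x -> x <= y -> y <= b -> `|h y - h x| <= V y - V x.
  move=> ax xy yb.
  have fin u v : a <= u -> u <= v -> v <= b -> total_variation u v h \is a fin_num.
    move=> au uv vb; apply/bounded_variationP => //.
    apply: (bounded_variationl uv vb).
    exact: (bounded_variationr au (le_trans uv vb) bvh).
  rewrite /V (total_variationD h ax xy) fineD ?fin ?(le_trans xy) //.
  rewrite addrAC subrr add0r -lee_fin fineK ?fin //.
  exact: total_variation_ge.
have ndV : {in `[a, b] &, nondecreasing_fun V}.
  move=> x y; rewrite !in_itv /= => /andP[ax _] /andP[_ yb] xy.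
  by rewrite -subr_ge0; exact: le_trans (normr_ge0 _) (incV _ _ ax xy yb).
have ndW : {in `[a, b] &, nondecreasing_fun W}.
  move=> x y; rewrite !in_itv /= => /andP[ax _] /andP[_ yb] xy.
  have := le_trans (ler_norm _) (incV _ _ ax xy yb); rewrite /W; lra.
have [g1 [ig1 Ig1 dg1]] := nondecreasing_abs_cont_density ab ndV acV.
have [g2 [ig2 Ig2 dg2]] := nondecreasing_abs_cont_density ab ndW acW.
have hE : h = V - W by apply/funext => t; rewrite !fctE /W; ring.
exists (g1 \- g2); split.
- have -> : EFin \o (g1 \- g2) = ((EFin \o g1) \- (EFin \o g2))%E by [].
  by apply: integrableB.
- move=> t tab; have mt : measurable (`]a, t]%classic : set (measurableTypeR R)).
    exact: measurable_itv.
  rewrite integralB_EFin //.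
  + rewrite -[X in (X - _)%E](Ig1 t tab) -[X in (_ - X)%E](Ig2 t tab) -EFinB.
    by congr (_%:E); rewrite /W; ring.
  + exact: integrableS ig1.
  + exact: integrableS ig2.
- apply: filterS2 dg1 dg2; first exact: (ae_filter_ringOfSetsType mu).
  move=> t d1 d2 tab; rewrite hE.
  exact: is_deriveB (d1 tab) (d2 tab).
Qed.

Lemma abs_cont_ae_derivable a b (h : R -> R) : abs_cont a b h ->
  {ae mu, forall t, `]a, b[%classic t -> derivable h t 1}.
Proof.
move=> ach; have [ab|ba] := ltP a b; last first.
  apply: aeW => t /=; rewrite in_itv /= => /andP[at_ tb].
  by move: (le_lt_trans ba (lt_trans at_ tb)); rewrite ltxx.
have [g [_ _]] := abs_cont_density ab ach.
apply: filterS; first exact: (ae_filter_ringOfSetsType mu).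
by move=> t + tab => /(_ tab) [].
Qed.

(** The density is almost everywhere the derivative, hence 0, and [h t - h a] is its integral. *)
Lemma abs_cont_derive0_cst a b (h : R -> R) : abs_cont a b h ->
  {ae mu, forall t, `]a, b[%classic t -> is_derive t 1 h 0} ->
  forall t, `[a, b]%classic t -> h t = h a.
Proof.
move=> ach h0 t; rewrite /= in_itv /= => /andP[at_ tb].
have := le_trans at_ tb; rewrite le_eqVlt => /predU1P[ab|ab].
  by congr h; apply/le_anti; rewrite at_ ab tb.
have [g [ig Ig dg]] := abs_cont_density ab ach.
apply/eqP; rewrite -subr_eq0 -eqe (Ig t) /= ?in_itv /= ?at_ //.
have mt : measurable (`]a, t]%classic : set (measurableTypeR R)).
  exact: measurable_itv.
rewrite (@ae_eq_integral _ _ _ mu _ (fun=> 0%E)) //.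
- by rewrite integral0.
- by move/integrableP : ig => [mg _]; exact: measurable_funS mg.
(* The integral runs over []a, t]], which contains [b] when [t = b], while derivatives are known on
   the open interval only; a single point is negligible. *)
- have : {ae mu, forall x : R, x != b}.
    exists [set b]; split => //; first exact: lebesgue_measure_set1.
    by move=> x /= /negP; rewrite negbK => /eqP.
  move=> nb; apply: filterS3 h0 dg nb; first exact: (ae_filter_ringOfSetsType mu).
  move=> x d0 d1 xb /=; rewrite in_itv /= => /andP[ax xt].
  have xab : `]a, b[%classic x.
    by rewrite /= in_itv /= ax lt_neqAle xb (le_trans xt).
  by have [_ <-] := d1 xab; have [_ ->] := d0 xab.
Qed.

End Density.

(** * Matrix-valued curves and almost everywhere statements *)

Section AbsContMx.
Context {R : realType} (a b : R).

Lemma abs_cont_sum (I : finType) (P : pred I) (h : I -> R -> R) :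
  (forall i, P i -> abs_cont a b (h i)) -> abs_cont a b (fun t => \sum_(i | P i) h i t).
Proof.
move=> ach; pose S r := abs_cont a b (fun t => \sum_(i <- r | P i) h i t).
suff : S (index_enum I) by [].
elim: (index_enum I) => [|i r IH]; rewrite /S.
  by apply: abs_cont_eq (abs_cont_cst a b 0) => t _; rewrite big_nil.
have [Pi|nPi] := boolP (P i); last first.
  by apply: abs_cont_eq IH => t _; rewrite big_cons (negPf nPi).
apply: abs_cont_eq (abs_contD (ach i Pi) IH) => t _.
by rewrite big_cons Pi.
Qed.

Lemma abs_cont_prod (I : finType) (h : I -> R -> R) :
  (forall i, abs_cont a b (h i)) -> abs_cont a b (fun t => \prod_i h i t).
Proof.
move=> ach; pose S r := abs_cont a b (fun t => \prod_(i <- r) h i t).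
suff : S (index_enum I) by [].
elim: (index_enum I) => [|i r IH]; rewrite /S.
  by apply: abs_cont_eq (abs_cont_cst a b 1) => t _; rewrite big_nil.
by apply: abs_cont_eq (abs_contM (ach i) IH) => t _; rewrite big_cons.
Qed.

Lemma abs_cont_det n (A : R -> 'M[R]_n) : abs_cont_mx a b A ->
  abs_cont a b (fun t => \det (A t)).
Proof.
move=> acA; apply: abs_cont_sum => s _; apply: abs_contZ.
by apply: abs_cont_prod => i; exact: acA.
Qed.

Lemma abs_cont_mulmx m n p (A : R -> 'M[R]_(m, n)) (B : R -> 'M[R]_(n, p)) :
  abs_cont_mx a b A -> abs_cont_mx a b B -> abs_cont_mx a b (fun t => A t *m B t).
Proof.
move=> acA acB i j.
apply: (@abs_cont_eq _ _ _ (fun t => \sum_k A t i k * B t k j)) => [t _|].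
  by rewrite mxE.
by apply: (@abs_cont_sum _ _ (fun k t => A t i k * B t k j)) => k _; exact: abs_contM.
Qed.

Lemma abs_cont_mx_cst m n (A : 'M[R]_(m, n)) : abs_cont_mx a b (fun=> A).
Proof. by move=> i j; exact: abs_cont_cst. Qed.

Lemma abs_cont_mx_eq m n (A B : R -> 'M[R]_(m, n)) :
  (forall t, `[a, b]%classic t -> A t = B t) -> abs_cont_mx a b A ->
  abs_cont_mx a b B.
Proof. by move=> AB acA i j; apply: abs_cont_eq (acA i j) => t /AB ->. Qed.

(** Cramer's rule: the entries of the inverse are cofactors divided by a determinant that does not
    vanish. *)
Lemma abs_cont_invmx n (A : R -> 'M[R]_n) : abs_cont_mx a b A ->
  (forall t, `[a, b]%classic t -> A t \in unitmx) ->
  abs_cont_mx a b (fun t => invmx (A t)).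
Proof.
move=> acA uA.
apply: (@abs_cont_mx_eq _ _ (fun t => (\det (A t))^-1 *: \adj (A t))) => [t tab|i j].
  by rewrite /invmx uA.
apply: (@abs_cont_eq _ _ _ (fun t => (\det (A t))^-1 *
    ((-1) ^+ (j + i) * \det (row' j (col' i (A t)))))) => [t _|]; first by rewrite !mxE.
apply: abs_contM.
  apply: abs_contV; first exact: abs_cont_det.
  by move=> t tab; rewrite -unitfE -unitmxE uA.
apply: abs_contZ; apply: abs_cont_det => k l.
by apply: abs_cont_eq (acA (lift j k) (lift i l)) => t _; rewrite !mxE.
Qed.

End AbsContMx.

(** * Derivatives of matrix-valued curves *)

Section TimeDerivative.
Context {R : realType}.
Implicit Types (t : R).

Lemma is_derive_mxP m n (A : R -> 'M[R]_(m, n)) t (D : 'M[R]_(m, n)) :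
  is_derive t 1 A D <->
  forall i j, is_derive t 1 (fun s => A s i j) (D i j).
Proof.
split=> [[dA <-] i j|dA].
  rewrite derive_mx // mxE; apply: derivableP.
  by move/derivable_mxP : dA; exact.
have dA' : derivable A t 1.
  by apply/derivable_mxP => i j; case: (dA i j).
apply: DeriveDef => //; rewrite derive_mx //; apply/matrixP => i j.
by rewrite mxE; case: (dA i j).
Qed.

Lemma is_derive_unique (V : normedModType R) (h : R -> V) t (d d' : V) :
  is_derive t 1 h d -> is_derive t 1 h d' -> d = d'.
Proof. by move=> [_ <-] [_ <-]. Qed.

Lemma is_derive_mulmx m n p (A : R -> 'M[R]_(m, n)) (B : R -> 'M[R]_(n, p)) t dA dB :
  is_derive t 1 A dA -> is_derive t 1 B dB ->
  is_derive t 1 (fun s => A s *m B s) (dA *m B t + A t *m dB).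
Proof.
move=> /is_derive_mxP hA /is_derive_mxP hB; apply/is_derive_mxP => i j.
have -> : (fun s => (A s *m B s) i j) = (fun s => \sum_k A s i k * B s k j).
  by apply/funext => s; rewrite mxE.
have dk (k : 'I_n) : is_derive t 1 (fun s => A s i k * B s k j)
    (dA i k * B t k j + A t i k * dB k j).
  have := @is_deriveM R R _ _ t 1 _ _ (hA i k) (hB k j).
  by rewrite /GRing.scale /= addrC [X in X + _]mulrC.
have := @is_derive_sum R R R n _ t 1 _ dk.
rewrite (_ : (\sum_k _)%R = (fun s => \sum_k A s i k * B s k j)).
  by rewrite big_split /= !mxE.
by apply/funext => s; rewrite fct_sumE.
Qed.

Lemma is_derive_mulmxl m n p (A : 'M[R]_(m, n)) (B : R -> 'M[R]_(n, p)) t dB :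
  is_derive t 1 B dB -> is_derive t 1 (fun s => A *m B s) (A *m dB).
Proof.
move=> dB'; have := is_derive_mulmx (is_derive_cst A t 1) dB'.
by rewrite mul0mx add0r.
Qed.

End TimeDerivative.

(** * Almost everywhere statements, local and global *)

Section AlmostEverywhere.
Context {R : realType}.
Notation mu := (@lebesgue_measure R).

(** The two end points are a null set. Interior times are what later steps need, since there curves
    that agree on [0, tau] agree in a neighbourhood. *)
Lemma ae_on_and tau (P Q S : R -> Prop) : ae_on tau P -> ae_on tau Q ->
  (forall t, 0 < t -> t < tau -> P t -> Q t -> S t) -> ae_on tau S.
Proof.
rewrite /ae_on => aeP aeQ PQS.
have ne c : {ae mu, forall x : R, x != c}.
  exists [set c]; split => //; first exact: lebesgue_measure_set1.
  by move=> x /= /negP; rewrite negbK => /eqP.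
have aePQ : {ae mu, forall t : R, `[0, tau]%classic t -> P t /\ Q t}.
  apply: filterS2 aeP aeQ; first exact: (ae_filter_ringOfSetsType mu).
  by move=> t Pt Qt tI; split; [exact: Pt|exact: Qt].
apply: filterS3 aePQ (ne 0) (ne tau); first exact: (ae_filter_ringOfSetsType mu).
move=> t PQ t0 tt tI; move: (tI); rewrite /= in_itv /= => /andP[t0' tt'].
have [Pt Qt] := PQ tI; apply: PQS => //; first by rewrite lt_neqAle eq_sym t0.
by rewrite lt_neqAle tt.
Qed.

Lemma ae_on_conj tau (P Q : R -> Prop) : ae_on tau P -> ae_on tau Q ->
  ae_on tau (fun t => P t /\ Q t).
Proof. by move=> aeP aeQ; apply: (ae_on_and aeP aeQ). Qed.

Lemma ae_on_imply tau (P S : R -> Prop) : ae_on tau P ->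
  (forall t, 0 < t -> t < tau -> P t -> S t) -> ae_on tau S.
Proof. by move=> aeP PS; apply: (ae_on_and aeP aeP) => t t0 tt Pt _; exact: PS. Qed.

Lemma ae_on_subitv tau a b (P : R -> Prop) : ae_on tau P -> 0 <= a -> b <= tau ->
  {ae mu, forall t, `]a, b[%classic t -> P t}.
Proof.
rewrite /ae_on => aeP a0 bt; apply: filterS aeP.
  exact: (ae_filter_ringOfSetsType mu).
move=> t Pt; rewrite /= in_itv /= => /andP[at_ tb]; apply: Pt.
by rewrite /= in_itv /= (le_trans a0 (ltW at_)) (le_trans (ltW tb)).
Qed.

Lemma ae_on_cover tau (C : R -> R -> Prop) (P : R -> Prop) :
  (forall t, 0 < t -> t < tau -> exists2 e, 0 < e &
    forall a b, 0 <= a -> b <= tau -> t - e < a -> b < t + e -> C a b) ->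
  (forall a b, 0 <= a -> b <= tau -> C a b ->
    {ae mu, forall t, `]a, b[%classic t -> P t}) ->
  ae_on tau P.
Proof.
(* The intervals with rational end points satisfying C cover ]0, tau[. *)
move=> cov aeC; pose ok (p : rat * rat) :=
  [/\ 0 <= ratr p.1 :> R, ratr p.2 <= tau :> R & C (ratr p.1) (ratr p.2)].
pose Q k (t : R) := if (unpickle k : option (rat * rat)) is Some p then
  ok p -> `]ratr p.1, ratr p.2[%classic t -> P t else True.
have aeQ : {ae mu, forall t, forall k, Q k t}.
  apply: ae_foralln => k; rewrite /Q; case: (unpickle k) => [p|]; last exact: aeW.
  have [[p1 p2 Cp]|nok] := pselect (ok p); last by apply: aeW => t /nok.
  apply: filterS (aeC _ _ p1 p2 Cp); first exact: (ae_filter_ringOfSetsType mu).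
  by move=> t Pt _; exact: Pt.
have ae1 : ae_on tau (fun t => forall k, Q k t).
  rewrite /ae_on; apply: filterS aeQ; first exact: (ae_filter_ringOfSetsType mu).
  by move=> t Qt _.
apply: (ae_on_imply ae1) => t t0 tt Qt.
have [e e0 hC] := cov t t0 tt.
have [|p pP] := @rat_in_itvoo R (Num.max 0 (t - e)) t.
  by rewrite gt_max t0 gtrBl.
have [|q qP] := @rat_in_itvoo R t (Num.min tau (t + e)).
  by rewrite lt_min tt ltrDl.
move: pP qP; rewrite !in_itv /= gt_max lt_min.
move=> /andP[/andP[p0 pe] pt] /andP[tq /andP[qt qe]].
have := Qt (pickle (p, q)); rewrite /Q pickleK; apply=> /=.
  by split; rewrite ?(ltW p0) ?(ltW qt) //; apply: hC => //; exact: ltW.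
by rewrite in_itv /= pt.
Qed.

(** Such a function is continuous with derivative 0 inside, so the mean value theorem on [0, t]
    applies. *)
Lemma locally_cst_itv tau (h : R -> R) :
  (forall t, `[0, tau]%classic t -> exists2 e, 0 < e &
    forall s, `[0, tau]%classic s -> `|s - t| < e -> h s = h t) ->
  forall t, `[0, tau]%classic t -> h t = h 0.
Proof.
move=> loc t tI; move: (tI); rewrite /= in_itv /= => /andP[t0 tt].
have itvI s : 0 <= s -> s <= t -> `[0, tau]%classic s.
  by move=> s0 st; rewrite /= in_itv /= s0 (le_trans st).
have [s||c _] := @MVT_segment R h (fun=> 0) 0 t t0.
- rewrite in_itv /= => /andP[s0 st].
  have [e e0 he] := loc s (itvI _ (ltW s0) (ltW st)).
  apply: (@near_eq_is_derive _ _ _ (cst (h s))).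
  near=> r; rewrite /cst (he r) //.
    apply: itvI; apply: ltW; first by near: r; exact: lt_nbhsr.
    by near: r; exact: lt_nbhsl.
- apply/subspace_continuousP => s; rewrite /= in_itv /= => /andP[s0 st].
  have [e e0 he] := loc s (itvI _ s0 st).
  apply/cvgrPdist_lt => d d0; rewrite near_withinE; near=> r.
  rewrite /= in_itv /= => /andP[r0 rt].
  rewrite /from_subspace (he r) ?subrr ?normr0 //.
    exact: itvI.
- by rewrite mul0r => /eqP; rewrite subr_eq0 => /eqP.
Unshelve. all: by end_near. Qed.

End AlmostEverywhere.

(** * Tangent vectors and frames *)

Section Linear.
Context {R : realType}.

Lemma dot_eq0 n (u : 'cV[R]_n) : dot u u = 0 -> u = 0.
Proof.
rewrite /dot mxE => /eqP; rewrite psumr_eq0; last first.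
  by move=> k _; rewrite mxE -expr2 sqr_ge0.
move=> /allP u0; apply/matrixP => k j; rewrite ord1 mxE; apply/eqP.
by have := u0 k (mem_index_enum _); rewrite mxE mulf_eq0 orbb.
Qed.

Lemma cV_basis n (u : 'cV[R]_n) : u = \sum_k u k 0 *: basis_vec k.
Proof.
rewrite [LHS]matrix_sum_delta; apply: eq_bigr => k _.
by rewrite big_ord1.
Qed.

Lemma special_orthogonal_tr n (A : 'M[R]_n) : special_orthogonal A ->
  special_orthogonal A^T.
Proof. by move=> [AA dA]; split; rewrite ?det_tr // trmxK mulmx1C. Qed.

Variables (V W : lmodType R) (q : V -> W).
Hypothesis q_lin : forall (c : R) v w, q (c *: v + w) = c *: q v + q w.

(** Linearity in [is_SO] is a bare equation on a plain function, so its consequences are derived by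
    hand. *)
Lemma linear_at0 : q 0 = 0.
Proof.
have := q_lin 1 0 0; rewrite !scale1r addr0 => /esym/eqP.
by rewrite -subr_eq0 addrK => /eqP.
Qed.

Lemma linear_comb (I : finType) (c : I -> R) (v : I -> V) :
  q (\sum_k c k *: v k) = \sum_k c k *: q (v k).
Proof.
by elim/big_rec2: _ => [|k w1 w2 _ <-]; [exact: linear_at0|rewrite q_lin].
Qed.

End Linear.

(** * Tangent vectors in charts, and frames as invertible matrices *)

Section Tangent.
Context {R : realType} {n : nat} (M : riemannianManifold R n).
Implicit Types (x : M) (i j : chart M).

Lemma tangentP x (v : tangent x) : is_tangent x v.
Proof. by apply/asboolP; exact: (tcoordP v). Qed.

Lemma tangent_ext x (v w : tangent x) : (forall i, v i = w i) -> v = w.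
Proof. by move=> vw; apply: val_inj; apply/funext. Qed.

(** The transition Jacobians determine the coordinates in every other chart around [x], and outside
    those the coordinates are 0. *)
Lemma tangent_eq_chart x i (v w : tangent x) : dom i x -> v i = w i -> v = w.
Proof.
move=> xi vw; have [v1 v2] := tangentP v; have [w1 w2] := tangentP w.
apply: tangent_ext => j; have [xj|xj] := pselect (dom j x).
  by rewrite (v1 i) // (w1 i) // vw.
by rewrite v2 // w2.
Qed.

(* [tangent_of x u] is [u] if [u] is tangent at [x], and 0 otherwise; it moves a
   vector between tangent spaces at provably equal points. *)
Definition tangent_of x (u : chart M -> 'cV[R]_n) : tangent x := insubd 0 u.

Lemma tangent_ofE x (u : chart M -> 'cV[R]_n) i :
  is_tangent x u -> tangent_of x u i = u i.
Proof.
move=> ux; have {}ux : u \in @tangent_pred R n M x by apply/asboolP.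
by rewrite -[in RHS](insubdK (0 : tangent x) ux).
Qed.

Lemma tcoord_lin x (c : R) (v w : tangent x) i : (c *: v + w) i = c *: v i + w i.
Proof. by []. Qed.

Lemma tcoord_sum x (I : finType) (c : I -> R) (v : I -> tangent x) i :
  (\sum_k c k *: v k) i = \sum_k c k *: v k i.
Proof. exact: (@linear_comb _ _ _ (fun w : tangent x => w i) (fun _ _ _ => erefl)). Qed.

Definition fmx (f : frame M) i : 'M[R]_n := \matrix_(k, l) f (basis_vec l) i k 0.

Lemma frame_lin (f : frame M) (c : R) u w : f (c *: u + w) = c *: f u + f w.
Proof. by case: (fr_SO f). Qed.

Lemma fmxE (f : frame M) i u : f u i = fmx f i *m u.
Proof.
rewrite [in LHS](cV_basis u) (linear_comb (frame_lin f)) tcoord_sum.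
apply/matrixP => k j; rewrite !ord1 summxE mxE; apply: eq_bigr => l _.
by rewrite !mxE mulrC.
Qed.

Lemma frame_inj (f : frame M) u : f u = 0 -> u = 0.
Proof.
move=> fu0; apply: dot_eq0; have [_ <- _] := fr_SO f.
by rewrite fu0 /inner /dot trmx0 mul0mx mxE.
Qed.

(** A kernel vector has an image that vanishes in one chart, hence is the zero tangent vector, and
    an isometry is injective. *)
Lemma fmx_unit (f : frame M) i : dom i (fr_pt f) -> fmx f i \in unitmx.
Proof.
move=> fi; rewrite -unitmx_tr -row_free_unit -kermx_eq0.
apply/negPn/negP => /rowV0Pn[u /sub_kermxP uG] /eqP; apply.
apply: trmx_inj; rewrite trmx0; apply: (@frame_inj f).
apply: (tangent_eq_chart fi); rewrite fmxE.
by apply: trmx_inj; rewrite trmx_mul trmxK uG trmx0.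
Qed.

(** The inverse of the frame. It takes a bare family of coordinates, so that it also accepts a
    vector at a point only provably equal to [fr_pt f]. *)
Definition fcoord (f : frame M) (u : chart M -> 'cV[R]_n) : 'cV[R]_n :=
  invmx (fmx f (chart_at (fr_pt f))) *m u (chart_at (fr_pt f)).

Lemma frame_fcoord (f : frame M) u i : is_tangent (fr_pt f) u ->
  f (fcoord f u) i = u i.
Proof.
move=> fu; rewrite -(tangent_ofE i fu); congr (tcoord _ i).
have fc := dom_chart_at (fr_pt f).
apply: (tangent_eq_chart fc).
by rewrite fmxE /fcoord mulKVmx ?fmx_unit // tangent_ofE.
Qed.

Lemma fcoordK (f : frame M) (v : tangent (fr_pt f)) : f (fcoord f v) = v.
Proof. by apply: tangent_ext => i; rewrite frame_fcoord //; exact: tangentP. Qed.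

Lemma frameK (f : frame M) u : fcoord f (f u) = u.
Proof. by rewrite /fcoord fmxE mulKmx // fmx_unit //; exact: dom_chart_at. Qed.

(** Regularity in time is read off in one fixed chart, whereas [chart_at] may jump as the base point
    moves. *)
Lemma fcoordE (f : frame M) u i : is_tangent (fr_pt f) u -> dom i (fr_pt f) ->
  fcoord f u = invmx (fmx f i) *m u i.
Proof.
by move=> fu fi; rewrite -(frame_fcoord i fu) fmxE mulKmx // fmx_unit.
Qed.

Lemma fcoord_lin (f : frame M) (c : R) (v w : tangent (fr_pt f)) :
  fcoord f (c *: v + w : tangent _) = c *: fcoord f v + fcoord f w.
Proof. by rewrite /fcoord tcoord_lin mulmxDr -scalemxAr. Qed.

Lemma det_cols_mulmx (b : 'I_n -> 'cV[R]_n) (A : 'M[R]_n) :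
  \det (\matrix_(k, l) (A *m b l) k 0) = \det A * \det (\matrix_(k, l) b l k 0).
Proof.
rewrite -det_mulmx; congr (\det _); apply/matrixP => k l.
by rewrite !mxE; apply: eq_bigr => j _; rewrite !mxE.
Qed.

(** The frame sends the standard basis to a positive one, so its matrix has positive determinant and
    also reflects orientation. *)
Lemma frame_posbasis (f : frame M) (u : 'I_n -> 'cV[R]_n) :
  tangent_posbasis (fun k => f (u k)) -> posbasis u.
Proof.
rewrite /tangent_posbasis /posbasis; set c := chart_at _.
have -> : \matrix_(k, l) f (u l) c k 0 = \matrix_(k, l) (fmx f c *m u l) k 0.
  by apply/matrixP => k l; rewrite !mxE fmxE mxE.
have [_ _ /(_ (@basis_vec R n))] := fr_SO f; rewrite /tangent_posbasis /posbasis.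
have -> : \matrix_(k, l) @basis_vec R n l k 0 = 1%:M.
  by apply/matrixP => k l; rewrite !mxE andbT.
rewrite det1 => /(_ ltr01); rewrite -/c -/(fmx f c) => dc.
by rewrite det_cols_mulmx pmulr_rgt0.
Qed.

End Tangent.

(** * Finite conjunctions and chartwise differentiability almost everywhere *)

Section AeForall.
Context {R : realType}.

Lemma ae_on_forall tau (I : finType) (P : I -> R -> Prop) :
  (forall i, ae_on tau (P i)) -> ae_on tau (fun t => forall i, P i t).
Proof.
rewrite /ae_on => aeP.
have : {ae @lebesgue_measure R, forall t i, `[0, tau]%classic t -> P i t}.
  exact: (filter_forall (ae_filter_ringOfSetsType lebesgue_measure)).
apply: filterS; first exact: (ae_filter_ringOfSetsType lebesgue_measure).
by move=> t Pt tI i; exact: Pt.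
Qed.

(** [C a b] is meant to say that the curve stays in fixed charts on [a, b]; absolute continuity is
    available on such intervals only. *)
Lemma abs_cont_mx_ae_derivable m n tau (C : R -> R -> Prop) (h : R -> 'M[R]_(m, n)) :
  (forall t, 0 < t -> t < tau -> exists2 e, 0 < e &
    forall a b, 0 <= a -> b <= tau -> t - e < a -> b < t + e -> C a b) ->
  (forall a b, 0 <= a -> b <= tau -> C a b -> abs_cont_mx a b h) ->
  ae_on tau (fun t => exists dh, is_derive t 1 h dh).
Proof.
move=> cov ach; apply: (ae_on_cover cov) => a b a0 bt Cab.
have : {ae @lebesgue_measure R, forall t (k : 'I_m * 'I_n), `]a, b[%classic t ->
    derivable (fun s => h s k.1 k.2) t 1}.
  apply: (filter_forall (ae_filter_ringOfSetsType lebesgue_measure)) => -[k l] /=.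
  exact: (abs_cont_ae_derivable (ach a b a0 bt Cab k l)).
apply: filterS; first exact: (ae_filter_ringOfSetsType lebesgue_measure).
move=> t dt tab; eexists; apply: derivableP; apply/derivable_mxP => k l.
exact: (dt (k, l)).
Qed.

End AeForall.

(** * Covariant derivatives in a horizontal frame *)

Section CovariantDerivative.
Context {R : realType} {n : nat} (M : riemannianManifold R n).
Implicit Types (x y : R -> M) (t : R).

Lemma velocity_unique x t (v w : tangent (x t)) :
  is_velocity v -> is_velocity w -> v = w.
Proof.
move=> vv vw; have xc := dom_chart_at (x t).
by apply: (tangent_eq_chart xc); apply: is_derive_unique (vv _ xc) (vw _ xc).
Qed.

Lemma covderiv_unique x (Z : forall t, tangent (x t)) t (W W' : tangent (x t)) :
  is_covderiv Z W -> is_covderiv Z W' -> W = W'.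
Proof.
move=> [v vv dZ] [v' vv' dZ']; have xc := dom_chart_at (x t).
rewrite -(velocity_unique vv vv') in dZ'.
apply: (tangent_eq_chart xc).
by have := is_derive_unique (dZ _ xc) (dZ' _ xc) => /addIr.
Qed.

(** Curves that agree near [t] still have distinct types of tangent vectors, so vectors are compared
    by their coordinates. *)
Lemma is_velocity_ext x y t (v : tangent (x t)) (w : tangent (y t)) :
  (\forall s \near t, x s = y s) -> (forall i, v i = w i) ->
  is_velocity v -> is_velocity w.
Proof.
move=> xy vw vv i yi; have xi : dom i (x t) by rewrite (nbhs_singleton xy).
rewrite -vw; apply: near_eq_is_derive (vv i xi).
by apply: filterS xy => s ->.
Qed.

Lemma is_tangent_eq (p q : M) (u : chart M -> 'cV[R]_n) :
  p = q -> is_tangent p u -> is_tangent q u.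
Proof. by move=> ->. Qed.

Lemma is_covderiv_ext x y (Z1 : forall t, tangent (x t))
    (Z2 : forall t, tangent (y t)) t (W1 : tangent (x t)) (W2 : tangent (y t)) :
  (\forall s \near t, x s = y s) ->
  (\forall s \near t, forall i, Z1 s i = Z2 s i) ->
  (forall i, W1 i = W2 i) ->
  is_covderiv Z1 W1 -> is_covderiv Z2 W2.
Proof.
move=> xy Z12 W12 [v vv dZ]; have xyt := nbhs_singleton xy.
have tv : is_tangent (y t) v by apply: is_tangent_eq (tangentP v).
exists (tangent_of (y t) v).
  by apply: is_velocity_ext vv => // i; rewrite tangent_ofE.
move=> i yi; have xi : dom i (x t) by rewrite xyt.
rewrite tangent_ofE // -W12 -(nbhs_singleton Z12) -xyt.
apply: near_eq_is_derive (dZ i xi).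
by apply: filterS Z12 => s ->.
Qed.

(** The connection form of the chart, evaluated on [u]. *)
Definition christoffel_mx (i : chart M) (p u : 'cV[R]_n) : 'M[R]_n :=
  \matrix_(k, b) \sum_a christoffel i p k a b * u a 0.

Lemma christoffel_appE i p u w :
  christoffel_app i p u w = christoffel_mx i p u *m w.
Proof.
apply/matrixP => k j; rewrite !ord1 !mxE exchange_big; apply: eq_bigr => b _.
by rewrite mxE mulr_suml.
Qed.

(** Parallel columns mean F' = - Gamma F for the frame matrix F, so in (F w)' = F' w + F w' the
    first term cancels the Christoffel term. *)
Lemma is_covderiv_frame (f : R -> frame M) t (v : tangent (fr_pt (f t))) w dw :
  @is_velocity R n M (fun s => fr_pt (f s)) t v ->
  (forall j, @is_covderiv R n M (fun s => fr_pt (f s))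
    (fun s => f s (basis_vec j)) t 0) ->
  is_derive t 1 w dw ->
  @is_covderiv R n M (fun s => fr_pt (f s)) (fun s => f s (w s)) t (f t dw).
Proof.
move=> vv hf hw; exists v => // i fi.
have dF : is_derive t 1 (fun s => fmx (f s) i)
    (- (christoffel_mx i (phi i (fr_pt (f t))) (v i) *m fmx (f t) i)).
  apply/is_derive_mxP => k l; have [v' vv' /(_ i fi)] := hf l.
  rewrite -(velocity_unique vv vv') => /is_derive_mxP /(_ k 0).
  have -> : (fun s => fmx (f s) i k l) = (fun s => f s (basis_vec l) i k 0).
    by apply/funext => s; rewrite mxE.
  rewrite christoffel_appE !mxE sub0r; congr (is_derive _ _ _ (- _)).
  by apply: eq_bigr => b _; rewrite !mxE.
have := is_derive_mulmx dF hw.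
have -> : (fun s => fmx (f s) i *m w s) = (fun s => f s (w s) i).
  by apply/funext => s; rewrite fmxE.
by rewrite christoffel_appE !fmxE mulNmx mulmxA addrC.
Qed.

Lemma is_covderiv_fcoord (f : R -> frame M) t (v : tangent (fr_pt (f t)))
    (Z : forall t, tangent (fr_pt (f t))) w :
  @is_velocity R n M (fun s => fr_pt (f s)) t v ->
  (forall j, @is_covderiv R n M (fun s => fr_pt (f s))
    (fun s => f s (basis_vec j)) t 0) ->
  is_derive t 1 (fun s => fcoord (f s) (Z s)) w ->
  @is_covderiv R n M (fun s => fr_pt (f s)) Z t (f t w).
Proof.
move=> vv hf hw; have := is_covderiv_frame vv hf hw.
apply: is_covderiv_ext => //; near=> s => // i.
by rewrite fcoordK.
Unshelve. all: by end_near. Qed.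

Lemma curve_chart_near tau x (i : chart M) t : {within `[0, tau], continuous x} ->
  `[0, tau]%classic t -> dom i (x t) ->
  exists2 e, 0 < e & forall s, `[0, tau]%classic s -> `|s - t| < e -> dom i (x s).
Proof.
move=> cx tI xi.
have /subspace_continuousP /(_ t tI) := cx.
have /[swap] /[apply] := open_nbhs_nbhs (conj (dom_open i) xi).
rewrite nbhs_simpl /= => /nbhs_ballP[e /= e0 be]; exists e => // s sI st.
by apply: be => //; rewrite /ball /= distrC.
Qed.

Lemma fmx_abs_cont tau (f : R -> frame M) i a b : horizontal tau f ->
  0 <= a -> b <= tau -> (forall t, `[a, b]%classic t -> dom i (fr_pt (f t))) ->
  abs_cont_mx a b (fun t => fmx (f t) i).
Proof.
move=> [_ hf] a0 bt fi k l; have [[_ acl] _] := hf l.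
by apply: abs_cont_eq (acl i a b a0 bt fi k 0) => t _; rewrite mxE.
Qed.

Lemma fcoord_abs_cont tau (f : R -> frame M) i a b (U : R -> chart M -> 'cV[R]_n) :
  horizontal tau f -> 0 <= a -> b <= tau ->
  (forall t, `[a, b]%classic t -> dom i (fr_pt (f t))) ->
  (forall t, `[a, b]%classic t -> is_tangent (fr_pt (f t)) (U t)) ->
  abs_cont_mx a b (fun t => U t i) ->
  abs_cont_mx a b (fun t => fcoord (f t) (U t)).
Proof.
move=> hf a0 bt fi tU acU.
apply: (@abs_cont_mx_eq _ _ _ _ _ (fun t => invmx (fmx (f t) i) *m U t i)) => [t tab|].
  by rewrite (fcoordE (tU t tab) (fi t tab)).
apply: abs_cont_mulmx => //; apply: abs_cont_invmx; first exact: fmx_abs_cont bt fi.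
by move=> t tab; apply: fmx_unit; exact: fi.
Qed.

Lemma fcoord_ae_derivable tau (f : R -> frame M) (Z : forall t, tangent (fr_pt (f t))) :
  horizontal tau f -> abs_cont_field tau Z ->
  ae_on tau (fun t => exists w, is_derive t 1 (fun s => fcoord (f s) (Z s)) w).
Proof.
move=> hf [[cx _] acZ].
apply: (@abs_cont_mx_ae_derivable _ _ _ _ (fun a b =>
  exists i, forall t, `[a, b]%classic t -> dom i (fr_pt (f t)))).
  move=> t t0 tt; have tI : `[0, tau]%classic t by rewrite /= in_itv /= !ltW.
  have [e e0 he] := curve_chart_near cx tI (dom_chart_at _).
  exists e => // a b a0 bt ta bt'; exists (chart_at (fr_pt (f t))) => s.
  rewrite /= in_itv /= => /andP[as_ sb]; apply: he.
    by rewrite /= in_itv /= (le_trans a0) // (le_trans sb).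
  by rewrite ltr_norml; apply/andP; split; lra.
move=> a b a0 bt [i fi].
exact: (fcoord_abs_cont hf a0 bt fi (fun t _ => tangentP (Z t)) (acZ i a b a0 bt fi)).
Qed.

Lemma horizontal_ae tau (f : R -> frame M) : horizontal tau f ->
  ae_on tau (fun t => forall j, @is_covderiv R n M (fun s => fr_pt (f s))
    (fun s => f s (basis_vec j)) t 0).
Proof. by move=> [_ hf]; apply: ae_on_forall => j; case: (hf j). Qed.

End CovariantDerivative.

(** * Rotations and rollings *)

Section Rotation.
Context {R : realType} {n : nat} (M : riemannianManifold R n).

Lemma dot_mulmx (A : 'M[R]_n) u w : dot (A *m u) (A *m w) = dot u (A^T *m A *m w).
Proof. by rewrite /dot trmx_mul !mulmxA. Qed.

Lemma dot_basis (A : 'M[R]_n) k l : dot (basis_vec k) (A *m basis_vec l) = A k l.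
Proof. by rewrite /dot trmx_delta -colE -rowE !mxE. Qed.

Lemma mulmx_lin (A : 'M[R]_n) (c : R) (u w : 'cV[R]_n) :
  A *m (c *: u + w) = c *: (A *m u) + A *m w.
Proof. by rewrite mulmxDr -scalemxAr. Qed.

Lemma posbasis_mulmx (A : 'M[R]_n) (b : 'I_n -> 'cV[R]_n) : \det A = 1 ->
  posbasis b -> posbasis (fun k => A *m b k).
Proof. by rewrite /posbasis det_cols_mulmx => ->; rewrite mul1r. Qed.

Lemma frame_mulmx_SO (f : frame M) (A : 'M[R]_n) : special_orthogonal A ->
  is_SO (@dot R n) (@inner R n M (fr_pt f)) (@posbasis R n)
    (@tangent_posbasis R n M (fr_pt f)) (fun u => f (A *m u)).
Proof.
move=> [AA dA]; have [_ f2 f3] := fr_SO f; split=> [c u w|u w|b bp].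
- by rewrite mulmx_lin frame_lin.
- by rewrite f2 dot_mulmx AA mul1mx.
- exact/f3/posbasis_mulmx.
Qed.

Definition frame_mulmx (f : frame M) (A : 'M[R]_n) (SA : special_orthogonal A) :=
  Frame (frame_mulmx_SO f SA).

(** [A e_j] is constant in time, so by [is_covderiv_frame] the covariant derivative of [f (A e_j)]
    is [f 0]. *)
Lemma horizontal_mulmx tau (f : R -> frame M) A (SA : special_orthogonal A) :
  horizontal tau f ->
  ae_on tau (fun t => exists v : tangent (fr_pt (f t)),
    @is_velocity R n M (fun s => fr_pt (f s)) t v) ->
  horizontal tau (fun t => frame_mulmx (f t) SA).
Proof.
move=> hf aev; split=> [|j]; first exact: hf.1.
split; first split; first exact: hf.1.
  move=> i a b a0 bt fi.
  apply: (@abs_cont_mx_eq _ _ _ _ _ (fun t => fmx (f t) i *m (A *m basis_vec j))).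
    by move=> t _; rewrite -fmxE.
  by apply: abs_cont_mulmx; [exact: (fmx_abs_cont hf a0 bt fi)|exact: abs_cont_mx_cst].
apply: ae_on_and aev (horizontal_ae hf) _ => t _ _ [v vv] fj.
have := is_covderiv_frame vv fj (is_derive_cst (A *m basis_vec j) t 1).
by rewrite (linear_at0 (frame_lin (f t))).
Qed.

Lemma antidevelopment_velocity tau (f : R -> frame M) y :
  ae_on tau (fun t => exists2 dy : 'cV[R]_n,
              is_derive t 1 y dy &
              @is_velocity R n M (fun s => fr_pt (f s)) t (f t dy)) ->
  ae_on tau (fun t => exists v : tangent (fr_pt (f t)),
    @is_velocity R n M (fun s => fr_pt (f s)) t v).
Proof. by move=> aey; apply: (ae_on_imply aey) => t _ _ [dy _]; exists (f t dy). Qed.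

(** If [f] serves [y = A y'], then the rotated frame [f A] serves [y'], because
    [f (A dy') = f dy]. *)
Lemma antidevelopment_mulmx tau (x : R -> M) (A : 'M[R]_n) y y' :
  special_orthogonal A -> antidevelopment tau x y ->
  y' 0 = 0 -> abs_cont_mx 0 tau y' ->
  ae_on tau (fun t => exists dy, is_derive t 1 y' dy) ->
  (forall t, `[0, tau]%classic t -> y t = A *m y' t) ->
  antidevelopment tau x y'.
Proof.
move=> SA [_ _ [f [hf fx aey]]] y'0 acy' aey' yy'; split=> //.
exists (fun t => frame_mulmx (f t) SA); split=> //.
  by apply: horizontal_mulmx => //; exact: antidevelopment_velocity aey.
apply: ae_on_and aey aey' _ => t t0 tt [dy hy vy] [dy' hy']; exists dy' => //=.
suff -> : A *m dy' = dy by [].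
apply: is_derive_unique hy; apply: near_eq_is_derive (is_derive_mulmxl A hy').
near=> s; rewrite yy' //= in_itv /=; apply/andP; split; apply: ltW.
  by near: s; exact: lt_nbhsr.
by near: s; exact: lt_nbhsl.
Unshelve. all: by end_near. Qed.

End Rotation.

(** * The rolling built from two horizontal frames and a rotation *)

Section RollingMap.
Context {R : realType} {n : nat} (M M' : riemannianManifold R n).

Lemma rolling_map_SO (f : frame M) (f' : frame M') (A : 'M[R]_n) :
  special_orthogonal A ->
  is_SO (@inner R n M (fr_pt f)) (@inner R n M' (fr_pt f'))
    (@tangent_posbasis R n M (fr_pt f)) (@tangent_posbasis R n M' (fr_pt f'))
    (fun v => f' (A *m fcoord f v)).
Proof.
move=> [AA dA]; have [_ f2 f3] := fr_SO f; have [_ f2' f3'] := fr_SO f'.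
split=> [c u w|u w|b bp].
- by rewrite fcoord_lin mulmx_lin frame_lin.
- by rewrite f2' dot_mulmx AA mul1mx -f2 !fcoordK.
- apply/f3'/posbasis_mulmx => //; apply: (@frame_posbasis _ _ _ f).
  by under eq_fun do rewrite fcoordK.
Qed.

Definition rolling_map (f : frame M) (f' : frame M') A (SA : special_orthogonal A) :
    Qspace M M' :=
  QPoint (rolling_map_SO f f' SA).

(** [A] represents f'^-1 q f, a composite of orientation preserving isometries. The relation is
    stated in coordinates because the base points are only provably equal. *)
Lemma SO_of_frames (f : frame M) (f' : frame M') (q : Qspace M M') (A : 'M[R]_n) :
  fr_pt f = q_pt q -> fr_pt f' = q_pt' q ->
  (forall u (v : tangent (q_pt q)), (forall i, v i = f u i) ->
    forall i, q v i = f' (A *m u) i) ->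
  special_orthogonal A.
Proof.
move=> ff' ff.
have [_ g2 g3] := fr_SO f; have [_ g2' g3'] := fr_SO f'.
have pos := @frame_posbasis _ _ _ f'.
(* Taking the records apart turns the base points into variables, which can then be identified. *)
case: f ff' g2 g3 => p F /= _ ff' g2 g3.
case: f' ff g2' g3' pos => p' F' /= _ ff g2' g3' pos.
case: q ff ff' => p1 p1' q [_ q2 q3] /= ff ff'; subst p1 p1' => qF.
have {}qF u : q (F u) = F' (A *m u) by apply: tangent_ext => i; exact: qF.
have AA : A^T *m A = 1%:M.
  apply/matrixP => k l; have := g2 (basis_vec k) (basis_vec l).
  rewrite -q2 !qF g2' dot_mulmx dot_basis => ->.
  by rewrite -[basis_vec l]mul1mx dot_basis.
split => //; have dA0 : 0 < \det A.
  have := pos (fun k => A *m basis_vec k).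
  have -> : (fun k => F' (A *m basis_vec k)) = (fun k => q (F (basis_vec k))).
    by apply/funext => k; rewrite qF.
  have b1 : posbasis (@basis_vec R n).
    rewrite /posbasis (_ : \matrix_(_, _) _ = 1%:M) ?det1 //.
    by apply/matrixP => k l; rewrite !mxE andbT.
  move=> /(_ (q3 _ (g3 _ b1))); rewrite /posbasis det_cols_mulmx.
  rewrite (_ : \matrix_(_, _) basis_vec _ _ _ = 1%:M) ?det1 ?mulr1 //.
  by apply/matrixP => k l; rewrite !mxE andbT.
(* The determinant has square 1 by orthogonality and is positive by orientation. *)
apply/eqP; rewrite -(@eqrXn2 _ 2) ?ltW // expr1n expr2.
by rewrite -{1}det_tr -det_mulmx AA det1.
Qed.

Lemma rolling_of_rotation tau (x : R -> M) (x' : R -> M') y y' (A : 'M[R]_n) :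
  antidevelopment tau x y -> antidevelopment tau x' y' -> special_orthogonal A ->
  (forall t, `[0, tau]%classic t -> y' t = A *m y t) -> rolling_along tau x x'.
Proof.
move=> [_ _ [f [hf fx aey]]] [_ _ [f' [hf' fx' aey']]] SA yy'.
exists (fun t => rolling_map (f t) (f' t) SA); last by move=> t tI; rewrite /= fx ?fx'.
split; first split; [exact: hf.1|exact: hf'.1| | |].
(* In charts the map is F' A F^-1, with F and F' the frame matrices. *)
- move=> i j a b a0 bt fij.
  exists (fun t => fmx (f' t) j *m (A *m invmx (fmx (f t) i))).
    apply: abs_cont_mulmx; first by apply: fmx_abs_cont hf' a0 bt _ => t /fij[].
    apply: abs_cont_mulmx; first exact: abs_cont_mx_cst.
    apply: abs_cont_invmx; first by apply: fmx_abs_cont hf a0 bt _ => t /fij[].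
    by move=> t /fij[? _]; exact: fmx_unit.
  move=> t /fij[/= fi _] v; rewrite fmxE -!mulmxA; congr (_ *m (_ *m _)).
  by rewrite (fcoordE (tangentP v) fi).
(* No slip: differentiating [y' = A y] gives [dy' = A dy]. *)
- apply: ae_on_and aey aey' _ => t t0 tt [dy hy vy] [dy' hy' vy'].
  exists (f t dy) => //=; rewrite frameK.
  suff -> : A *m dy = dy' by [].
  apply: is_derive_unique hy'; apply: near_eq_is_derive (is_derive_mulmxl A hy).
  near=> s; rewrite yy' //= in_itv /=; apply/andP; split; apply: ltW.
    by near: s; exact: lt_nbhsr.
  by near: s; exact: lt_nbhsl.
- move=> Z acZ.
  (* No twist: with [w] the derivative of f^-1 Z, the covariant derivatives of Z and q Z are [f w]
     and [f' (A w)]. *)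
  have aev := ae_on_conj aey aey'.
  have aej := ae_on_conj (horizontal_ae hf) (horizontal_ae hf').
  have aevj := ae_on_conj aev aej.
  apply: ae_on_and (fcoord_ae_derivable hf acZ) aevj _.
  move=> t _ _ [w hz] [[[dy _ vy] [dy' _ vy']] [fj fj']].
  exists (f t w) => /=; first exact: is_covderiv_fcoord vy fj hz.
  by rewrite frameK; exact: is_covderiv_frame vy' fj' (is_derive_mulmxl A hz).
Unshelve. all: by end_near. Qed.

End RollingMap.

(** * The constant rotation determined by a rolling *)

Section RotationOfRolling.
Context {R : realType} {n : nat} (M M' : riemannianManifold R n).
Variables (tau : R) (q : R -> Qspace M M') (f : R -> frame M) (f' : R -> frame M').
Hypotheses (qr : is_rolling tau q) (hf : horizontal tau f) (hf' : horizontal tau f').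
Hypothesis qf : forall t, `[0, tau]%classic t -> fr_pt (f t) = q_pt (q t).
Hypothesis qf' : forall t, `[0, tau]%classic t -> fr_pt (f' t) = q_pt' (q t).

(* [Z j] is the field [f_j], retyped as a field along [q_pt \o q]; the base
   points agree on [0, tau] only. *)
Let Z j t : tangent (q_pt (q t)) := tangent_of (q_pt (q t)) (f t (basis_vec j)).
(** The image of [f_j] under [q], read in the frame [f']; thus [C] is the matrix of f'^-1 q f. *)
Let c j t : 'cV[R]_n := fcoord (f' t) (q t (Z j t)).
Let C t : 'M[R]_n := \matrix_(k, j) c j t k 0.

Let near_itv t : 0 < t -> t < tau -> \forall s \near t, `[0, tau]%classic s.
Proof.
move=> t0 tt; near=> s; rewrite /= in_itv /=; apply/andP; split; apply: ltW.
  by near: s; exact: lt_nbhsr.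
by near: s; exact: lt_nbhsl.
Unshelve. all: by end_near. Qed.

Let ZE j t i : `[0, tau]%classic t -> Z j t i = f t (basis_vec j) i.
Proof.
move=> tI; rewrite tangent_ofE //.
by apply: is_tangent_eq (qf tI) _; exact: tangentP.
Qed.

Let qZE j t i : `[0, tau]%classic t -> f' t (c j t) i = q t (Z j t) i.
Proof.
move=> tI; apply: frame_fcoord.
by apply: is_tangent_eq (esym (qf' tI)) _; exact: tangentP.
Qed.

Let qE t u (v : tangent (q_pt (q t))) : `[0, tau]%classic t ->
  (forall i, v i = f t u i) -> forall i, q t v i = f' t (C t *m u) i.
Proof.
move=> tI vu i; have [q_lin _ _] := q_SO (q t).
have -> : v = \sum_k u k 0 *: Z k t.
  apply: tangent_ext => k; rewrite vu tcoord_sum [in LHS](cV_basis u).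
  rewrite (linear_comb (frame_lin (f t))) tcoord_sum.
  by apply: eq_bigr => l _; rewrite ZE.
rewrite (linear_comb q_lin) tcoord_sum.
have -> : C t *m u = \sum_k u k 0 *: c k t.
  apply/matrixP => k l; rewrite ord1 summxE mxE.
  by apply: eq_bigr => m _; rewrite !mxE mulrC.
rewrite (linear_comb (frame_lin (f' t))) tcoord_sum.
by apply: eq_bigr => l _; rewrite qZE.
Qed.

Let Z_abs_cont j : abs_cont_field tau (Z j).
Proof.
have [[acq _ _] _ _] := qr; split=> // i a b a0 bt qi.
have abI t : `[a, b]%classic t -> `[0, tau]%classic t.
  by rewrite /= !in_itv /= => /andP[at_ tb]; rewrite (le_trans a0) // (le_trans tb).
have [[_ acf] _] := hf.2 j.
apply: abs_cont_mx_eq (acf i a b a0 bt _) => [t /abI tI|t tab]; first by rewrite ZE.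
by rewrite qf; [exact: qi|exact: abI].
Qed.

Let Z_parallel j : ae_on tau (fun t =>
  @is_covderiv R n M (fun s => q_pt (q s)) (Z j) t 0).
Proof.
apply: (ae_on_imply (horizontal_ae hf)) => t t0 tt /(_ j).
have nt := near_itv t0 tt.
apply: is_covderiv_ext => //; first by apply: filterS nt => s /qf.
by apply: filterS nt => s sI i; rewrite ZE.
Qed.

(** No twist applied to the parallel field [Z j]: its covariant derivative is 0 by uniqueness, and
    [q] maps 0 to 0. *)
Let qZ_parallel j : ae_on tau (fun t => @is_covderiv R n M' (fun s => fr_pt (f' s))
  (fun s => f' s (c j s)) t 0).
Proof.
have [_ _ /(_ _ (Z_abs_cont j)) twist] := qr.
apply: ae_on_and twist (Z_parallel j) _ => t t0 tt [W ZW qW] Z0.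
have [q_lin _ _] := q_SO (q t).
move: qW; rewrite (covderiv_unique ZW Z0) (linear_at0 q_lin).
have nt := near_itv t0 tt.
apply: is_covderiv_ext => //; first by apply: filterS nt => s /qf'.
by apply: filterS nt => s sI i; rewrite qZE.
Qed.

Let good a b := exists (i : chart M) (j : chart M'), forall t, `[a, b]%classic t ->
  dom i (fr_pt (f t)) /\ dom j (fr_pt (f' t)).

Let good_near t : `[0, tau]%classic t -> exists2 e, 0 < e &
  forall a b, 0 <= a -> b <= tau -> t - e < a -> b < t + e -> good a b.
Proof.
move=> tI; have [[cx _] _] := hf; have [[cx' _] _] := hf'.
have [e e0 he] := curve_chart_near cx tI (dom_chart_at _).
have [e' e0' he'] := curve_chart_near cx' tI (dom_chart_at _).
exists (Num.min e e'); first by rewrite lt_min e0.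
move=> a b a0 bt ta bt'; exists (chart_at (fr_pt (f t))), (chart_at (fr_pt (f' t))) => s.
rewrite /= in_itv /= => /andP[as_ sb].
have sI : `[0, tau]%classic s by rewrite /= in_itv /= (le_trans a0) // (le_trans sb).
have : `|s - t| < Num.min e e' by rewrite ltr_norml; apply/andP; split; lra.
by rewrite lt_min => /andP[? ?]; split; [exact: he|exact: he'].
Qed.

(** In one pair of charts, [q] acts through an absolutely continuous matrix, and so does the inverse
    of [f']. *)
Let c_abs_cont k a b : 0 <= a -> b <= tau -> good a b -> abs_cont_mx a b (c k).
Proof.
move=> a0 bt [i [j ij]].
have abI t : `[a, b]%classic t -> `[0, tau]%classic t.
  by rewrite /= !in_itv /= => /andP[at_ tb]; rewrite (le_trans a0) // (le_trans tb).
apply: (@fcoord_abs_cont _ _ _ _ _ j _ _ _ hf' a0 bt).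
- by move=> t /ij[].
- by move=> t /abI tI; apply: is_tangent_eq (esym (qf' tI)) _; exact: tangentP.
have [[_ _ acQ] _ _] := qr.
have [t tab|A acA qA] := acQ i j a b a0 bt.
  by rewrite -qf -?qf'; [exact: ij|exact: abI..].
apply: (@abs_cont_mx_eq _ _ _ _ _ (fun t => A t *m Z k t i)) => [t tab|].
  by rewrite qA.
apply: abs_cont_mulmx => //; have [_ acZ] := Z_abs_cont k.
by apply: acZ => // t tab; rewrite -qf; [case: (ij t tab)|exact: abI].
Qed.

(** The covariant derivative of [f' c] is [f' dc] since [f'] is horizontal, and 0 by [qZ_parallel];
    [f'] is injective. *)
Let c_derive0 k : ae_on tau (fun t => is_derive t 1 (c k) 0).
Proof.
have aed : ae_on tau (fun t => exists dh, is_derive t 1 (c k) dh).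
  apply: (@abs_cont_mx_ae_derivable _ _ _ _ good); last exact: c_abs_cont.
  by move=> t t0 tt; apply: good_near; rewrite /= in_itv /= !ltW.
have aed0 := ae_on_conj aed (qZ_parallel k).
apply: ae_on_and aed0 (horizontal_ae hf') _ => t t0 tt [[dh hc] c0] fj'.
have [v vv _] := c0.
have := covderiv_unique (is_covderiv_frame vv fj' hc) c0.
by move=> /frame_inj dh0; rewrite -dh0.
Qed.

(** Absolute continuity of [c] holds within a pair of charts, so constancy is first obtained near
    each time and then on the whole interval. *)
Let c_cst k t : `[0, tau]%classic t -> c k t = c k 0.
Proof.
move=> tI; apply/matrixP => l j; rewrite !ord1.
apply: (@locally_cst_itv R tau (fun t => c k t l 0)) tI => {}t tI.
have [e e0 he] := good_near tI; exists (e / 2); first by rewrite divr_gt0.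
(* Half of [e] leaves room for the strict inequalities in [good_near]. *)
move=> s sI st; pose a := Num.max 0 (t - e / 2); pose b := Num.min tau (t + e / 2).
have a0 : 0 <= a by rewrite le_max lexx.
have bt : b <= tau by rewrite ge_min lexx.
have gab : good a b.
  apply: he => //.
    by rewrite lt_max; apply/orP; right; lra.
  by rewrite gt_min; apply/orP; right; lra.
have c0 : {ae @lebesgue_measure R, forall r, `]a, b[%classic r ->
    is_derive r 1 (fun s => c k s l 0) 0}.
  have := ae_on_subitv (c_derive0 k) a0 bt.
  apply: filterS; first exact: (ae_filter_ringOfSetsType lebesgue_measure).
  by move=> r + rab => /(_ rab) /is_derive_mxP /(_ l 0); rewrite mxE.
have inab r : `[0, tau]%classic r -> `|r - t| < e / 2 -> `[a, b]%classic r.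
  rewrite /= !in_itv /= ge_max le_min ltr_norml => /andP[-> ->] /andP[r1 r2].
  by apply/andP; split; rewrite ?andbT /=; lra.
have cst := abs_cont_derive0_cst (c_abs_cont k a0 bt gab l 0) c0.
rewrite cst ?[in RHS]cst //; apply: inab => //.
by rewrite subrr normr0 divr_gt0.
Qed.

(** [y' - C 0 *m y] is absolutely continuous, starts at 0 and has derivative 0 almost everywhere. *)
Lemma rotation_of_rolling y y' :
  0 <= tau -> y 0 = 0 -> y' 0 = 0 -> abs_cont_mx 0 tau y -> abs_cont_mx 0 tau y' ->
  ae_on tau (fun t => exists2 dy : 'cV[R]_n, is_derive t 1 y dy &
    @is_velocity R n M (fun s => fr_pt (f s)) t (f t dy)) ->
  ae_on tau (fun t => exists2 dy : 'cV[R]_n, is_derive t 1 y' dy &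
    @is_velocity R n M' (fun s => fr_pt (f' s)) t (f' t dy)) ->
  exists2 A : 'M[R]_n, special_orthogonal A &
    forall t, `[0, tau]%classic t -> y' t = A *m y t.
Proof.
move=> tau0 y0 y'0 acy acy' aey aey'.
have I0 : `[0, tau]%classic (0 : R) by rewrite /= in_itv /= lexx.
have C_cst t : `[0, tau]%classic t -> C t = C 0.
  by move=> tI; apply/matrixP => k l; rewrite [LHS]mxE [RHS]mxE c_cst.
exists (C 0).
  by apply: (SO_of_frames (qf I0) (qf' I0)) => u v; exact: qE.
have acd : abs_cont_mx 0 tau (fun t => y' t - C 0 *m y t).
  move=> k l; have acCy := abs_cont_mulmx (abs_cont_mx_cst 0 tau (C 0)) acy.
  apply: abs_cont_eq (abs_contD (acy' k l) (abs_contN (acCy k l))) => t _.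
  by rewrite !mxE.
have aed : ae_on tau (fun t => is_derive t 1 (fun t => y' t - C 0 *m y t) 0).
  have [_ slip _] := qr.
  have aeyy := ae_on_conj aey aey'.
  apply: ae_on_and aeyy slip _ => t t0 tt [[dy hy vy] [dy' hy' vy']] [v vv qv].
  have nt := near_itv t0 tt; have tI := nbhs_singleton nt.
  (* By uniqueness the velocities in the no slip condition are [f dy] and [f' dy'], so f' dy' = q f
     dy = f' C dy. *)
  have vE i : v i = f t dy i.
    have tv : is_tangent (fr_pt (f t)) v.
      by apply: is_tangent_eq (esym (qf tI)) _; exact: tangentP.
    rewrite -(tangent_ofE i tv); congr (tcoord _ i); apply: velocity_unique vy.
    apply: is_velocity_ext vv; first by apply: filterS nt => s /qf.
    by move=> j; rewrite tangent_ofE.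
  have qvE i : q t v i = f' t dy' i.
    have tv : is_tangent (fr_pt (f' t)) (q t v).
      by apply: is_tangent_eq (esym (qf' tI)) _; exact: tangentP.
    rewrite -(tangent_ofE i tv); congr (tcoord _ i); apply: velocity_unique vy'.
    apply: is_velocity_ext qv; first by apply: filterS nt => s /qf'.
    by move=> j; rewrite tangent_ofE.
  have -> : 0 = dy' - C 0 *m dy.
    apply/esym/eqP; rewrite subr_eq0; apply/eqP.
    rewrite -(frameK (f' t) dy') -(frameK (f' t) (_ *m _)).
    by congr fcoord; apply/funext => i; rewrite -qvE -(C_cst t tI); exact: qE.
  exact: is_deriveB hy' (is_derive_mulmxl _ hy).
move=> t tI; apply/eqP; rewrite -subr_eq0; apply/eqP/matrixP => k l; rewrite ord1.
have d0 : {ae @lebesgue_measure R, forall r, `]0, tau[%classic r ->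
    is_derive r 1 (fun t => (y' t - C 0 *m y t) k 0) 0}.
  have := ae_on_subitv aed (lexx 0) (lexx tau).
  apply: filterS; first exact: (ae_filter_ringOfSetsType lebesgue_measure).
  by move=> r + rab => /(_ rab) /is_derive_mxP /(_ k 0); rewrite mxE.
rewrite (abs_cont_derive0_cst (acd k 0) d0 tI).
by rewrite y0 y'0 mulmx0 subrr.
Qed.

End RotationOfRolling.

Theorem theorem3 (R : realType) (n : nat) (M M' : riemannianManifold R n)
    (connM : connected [set: M]) (connM' : connected [set: M'])
    (tau : R) (tau_gt0 : 0 < tau)
    (x : R -> M) (x' : R -> M')
    (acx : abs_cont_curve tau x) (acx' : abs_cont_curve tau x')
    (y y' : R -> 'cV[R]_n)
    (xy : antidevelopment tau x y) (xy' : antidevelopment tau x' y') :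
  (rolling_along tau x x' <->
     exists2 iota : 'M[R]_n, special_orthogonal iota &
       forall t, `[0, tau]%classic t -> y' t = iota *m y t) /\
  (rolling_along tau x x' <->
     [set z | antidevelopment tau x z] = [set z | antidevelopment tau x' z]).
Proof.
(* Stated for arbitrary anti-developments, as the equality of sets compares each of them with [y] or
   [y']. *)
have rotation z z' : antidevelopment tau x z -> antidevelopment tau x' z' ->
    rolling_along tau x x' -> exists2 iota : 'M[R]_n, special_orthogonal iota &
       forall t, `[0, tau]%classic t -> z' t = iota *m z t.
  move=> [z0 acz [f [hf fx aez]]] [z'0 acz' [f' [hf' fx' aez']]] [q qr qx].
  apply: (rotation_of_rolling qr hf hf') aez aez' => //.
  - by move=> t tI; rewrite fx //; have [-> _] := qx t tI.
  - by move=> t tI; rewrite fx' //; have [_ ->] := qx t tI.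
  - exact: ltW.
have ae_der m (N : riemannianManifold R m) (p : R -> N) z : antidevelopment tau p z ->
    ae_on tau (fun t => exists dz, is_derive t 1 z dz).
  move=> [_ _ [f [_ _ aez]]].
  by apply: (ae_on_imply aez) => t _ _ [dz hz _]; exists dz.
split; split=> [roll|].
- exact: rotation xy xy' roll.
- by move=> [iota Siota yy']; exact: rolling_of_rotation xy xy' Siota yy'.
- apply/seteqP; split=> z /= xz.
  (* Since [y'] is a rotation of [z], the horizontal frame behind [y'] can be rotated to one with
     anti-development [z]. *)
  + have [iota Siota zy'] := rotation _ _ xz xy' roll; have [z0 acz _] := xz.
    by apply: (antidevelopment_mulmx Siota xy') => //; exact: ae_der xz.
  + have [iota Siota yz] := rotation _ _ xy xz roll; have [z0 acz _] := xz.
    apply: (antidevelopment_mulmx (special_orthogonal_tr Siota) xy) => //.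
      exact: ae_der xz.
    by move=> t tI; rewrite yz // mulmxA Siota.1 mul1mx.
(* Equal sets make [y] an anti-development of both curves, and the identity is then the required
   rotation. *)
- move=> /seteqP[sub _]; have x'y : antidevelopment tau x' y by exact: sub.
  apply: (rolling_of_rotation xy x'y (A := 1%:M)) => [|t _]; last by rewrite mul1mx.
  by split; rewrite ?trmx1 ?mul1mx ?det1.
Qed.
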